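(* Let $\mathcal X,\mathcal Y,\mathcal Z$ be finite-dimensional real Euclidean spaces, $f:\mathcal Y\to(-\infty,+\infty]$ and $g:\mathcal Z\to(-\infty,+\infty]$ closed proper convex functions, $\mathcal A:\mathcal X\to\mathcal Y$ and $\mathcal B:\mathcal X\to\mathcal Z$ linear maps with adjoints $\mathcal A^*,\mathcal B^*$, and $c\in\mathcal X$. Consider the primal problem $$\min_{y\in\mathcal Y,\,z\in\mathcal Z}\{f(y)+g(z)\ :\ \mathcal A^*y+\mathcal B^*z=c\},$$ its dual problem $$\max_{x\in\mathcal X}\{-f^*(-\mathcal A x)-g^*(-\mathcal B x)-\langle c,x\rangle\},$$ and its KKT system in $(x,y,z)\in\mathcal X\times\mathcal Y\times\mathcal Z$: $$-\mathcal A x\in\partial f(y),\quad -\mathcal B x\in\partial g(z),\quad \mathcal A^*y+\mathcal B^*z=c.$$ Let $\sigma>0$, $\tau>0$, and let $\mathcal S:\mathcal Y\to\mathcal Y$, $\mathcal T:\mathcal Z\to\mathcal Z$ be self-adjoint positive semidefinite linear operators. Assume that the solution set of the KKT system is nonempty. Suppose that the sPADMM scheme (defined in the context), started from some $(x^0,y^0,z^0)\in\mathcal X\times\operatorname{dom} f\times\operatorname{dom} g$, generates an infinite sequence $\{(x^k,y^k,z^k)\}_{k\ge0}$ (which is guaranteed to be true if Assumptions 1 and 2 of the context hold). If either $\tau\in\big(0,(1+\sqrt5)/2\big)$, or $\tau\ge(1+\sqrt5)/2$ and $\sum_{k=0}^\infty\|x^{k+1}-x^k\|^2<+\infty$, then: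 (a) the sequence $\{x^k\}$ converges to an optimal solution of the dual problem, and the sequence $\{f(y^k)+g(z^k)\}$ of primal objective function values converges to the optimal value; (b) the sequences $\{f(y^k)\}$ and $\{g(z^k)\}$ are bounded, and if Assumptions 3 and 4 of the context hold, then the sequences $\{y^k\}$ and $\{z^k\}$ are also bounded; (c) any accumulation point of $\{(x^k,y^k,z^k)\}$ is a solution to the KKT system, and if $(x^\infty,y^\infty,z^\infty)$ is one of its accumulation points, then, as $k\to\infty$, $\mathcal A^*y^k\to\mathcal A^*y^\infty$, $(\Sigma_f+\mathcal S)y^k\to(\Sigma_f+\mathcal S)y^\infty$, $\mathcal B^*z^k\to\mathcal B^*z^\infty$ and $(\Sigma_g+\mathcal T)z^k\to(\Sigma_g+\mathcal T)z^\infty$; (d) if $\Sigma_f+\mathcal A\mathcal A^*+\mathcal S\succ0$ and $\Sigma_g+\mathcal B\mathcal B^*+\mathcal T\succ0$, then each of the subproblems in the sPADMM scheme has a unique optimal solution and the whole sequence $\{(x^k,y^k,z^k)\}$ converges to a solution to the KKT system.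
   Context: For a self-adjoint positive semidefinite linear operator $\mathcal O$, $\|u\|_{\mathcal O}:=\sqrt{\langle u,\mathcal O u\rangle}$; $\mathcal O\succ0$ means positive definite. $\partial$ denotes the convex subdifferential, $f^*$ and $g^*$ the Fenchel conjugates, and $\operatorname{dom}$ the effective domain. The augmented Lagrangian is $$\mathcal L_\sigma(y,z;x):=f(y)+g(z)+\langle x,\mathcal A^*y+\mathcal B^*z-c\rangle+\tfrac{\sigma}{2}\|\mathcal A^*y+\mathcal B^*z-c\|^2.$$ The sPADMM (semi-proximal alternating direction method of multipliers) scheme, with step-length $\tau$, is, for $k=0,1,\dots$, $$y^{k+1}\in\arg\min_{y}\{\mathcal L_\sigma(y,z^k;x^k)+\tfrac12\|y-y^k\|_{\mathcal S}^2\},$$ $$z^{k+1}\in\arg\min_{z}\{\mathcal L_\sigma(y^{k+1},z;x^k)+\tfrac12\|z-z^k\|_{\mathcal T}^2\},$$ $$x^{k+1}=x^k+\tau\sigma(\mathcal A^*y^{k+1}+\mathcal B^*z^{k+1}-c).$$ It generates an infinite sequence if at every iteration both subproblems have a minimizer and some minimizer is selected. $\Sigma_f:\mathcal Y\to\mathcal Y$ and $\Sigma_g:\mathcal Z\to\mathcal Z$ are self-adjoint positive semidefinite linear operators such that $\langle v-v',y-y'\rangle\ge\|y-y'\|_{\Sigma_f}^2$ whenever $v\in\partial f(y)$, $v'\in\partial f(y')$, and $\langle w-w',z-z'\rangle\ge\|z-z'\|_{\Sigma_g}^2$ whenever $w\in\partial g(z)$, $w'\in\partial g(z')$ (such operators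 always exist, e.g. $0$). For a closed proper convex function $\theta$, its recession function is $\theta0^+(u):=\lim_{\rho\to+\infty}\frac{\theta(u'+\rho u)-\theta(u')}{\rho}$ for an arbitrary $u'\in\operatorname{dom}\theta$ (the value does not depend on $u'$). Assumption 1: $f0^+(y)>0$ for every $y\in\{y\in\mathcal Y:\mathcal A^*y=0,\ \mathcal S y=0\}\setminus\{y\in\mathcal Y: f0^+(-y)=-f0^+(y)=0\}$. Assumption 2: $g0^+(z)>0$ for every $z\in\{z\in\mathcal Z:\mathcal B^*z=0,\ \mathcal T z=0\}\setminus\{z\in\mathcal Z: g0^+(-z)=-g0^+(z)=0\}$. Assumption 3: $f0^+(y)>0$ for every nonzero $y\in\mathcal Y$ with $\mathcal A^*y=0$ and $\mathcal S y=0$. Assumption 4: $g0^+(z)>0$ for every nonzero $z\in\mathcal Z$ with $\mathcal B^*z=0$ and $\mathcal T z=0$. *)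

(* Defs.v *)
From HB Require Import structures.
From mathcomp Require Import all_boot all_order all_algebra.
From mathcomp Require Import all_classical all_reals all_analysis.

Set Implicit Arguments.
Unset Strict Implicit.
Unset Printing Implicit Defensive.

Import Order.TTheory GRing.Theory Num.Theory.
Import numFieldNormedType.Exports.

Local Open Scope classical_set_scope.
Local Open Scope ring_scope.

(* Finite-dimensional real Euclidean spaces: a vectType (finite-dimensional)
   that is also a normed module, with an inner product inducing the norm, so
   that the library's topology, limits and cluster points are the Euclidean
   ones. *)
HB.mixin Record NormedVector_isEuclidean (R : realType) V
    of NormedModule R V & Vector R V := {
  euclid_dot : {dot V for idfun} ;
  euclid_normE : forall u : V, `|u| = Num.sqrt (euclid_dot u u)
}.

#[short(type="euclideanType")]
HB.structure Definition Euclidean (R : realType) :=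
  {V of NormedModule R V & Vector R V & NormedVector_isEuclidean R V}.

Definition inner (R : realType) (V : euclideanType R) (u v : V) : R :=
  euclid_dot u v.

Section Operators.
Context {R : realType}.

Definition adjoint (V W : euclideanType R) (L : V -> W) (Ls : W -> V) : Prop :=
  forall v w, inner (L v) w = inner v (Ls w).

Definition self_adjoint (V : euclideanType R) (O : V -> V) : Prop :=
  adjoint O O.

Definition psd (V : euclideanType R) (O : V -> V) : Prop :=
  self_adjoint O /\ forall u, 0 <= inner u (O u).

Definition posdef (V : euclideanType R) (O : V -> V) : Prop :=
  self_adjoint O /\ forall u, u != 0 -> 0 < inner u (O u).

Definition opnorm (V : euclideanType R) (O : V -> V) (u : V) : R :=
  Num.sqrt (inner u (O u)).

End Operators.

Section ConvexAnalysis.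
Context {R : realType} {V : euclideanType R}.
Implicit Types (f : V -> \bar R) (u v : V).

Local Open Scope ereal_scope.

Definition dom f : set V := [set y | f y < +oo].

Definition proper f : Prop := (forall y, -oo < f y) /\ dom f !=set0.

(* At the endpoints of [0, 1] this relies on 0 * +oo = 0. *)
Definition convex f : Prop :=
  forall (t : R) u v, (0 <= t <= 1)%R ->
    f (t *: u + (1 - t) *: v)%R <= t%:E * f u + (1 - t)%:E * f v.

(* For proper convex functions, closed means lower semicontinuous. *)
Definition closed_proper_convex f : Prop :=
  [/\ lower_semicontinuous f, proper f & convex f].

Definition subdiff f (y : V) : set V :=
  [set v | forall y', f y + (inner v (y' - y)%R)%:E <= f y'].

Definition conjugate f (v : V) : \bar R :=
  ereal_sup [set (inner v y)%:E - f y | y in [set: V]].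

(* The base point is an arbitrary element of dom f, picked by choice; the
   limit does not depend on it when f is closed proper convex. *)
Definition recession f (u : V) : \bar R :=
  let u0 := xget 0%R (dom f) in
  lim ((f (u0 + rho *: u)%R - f u0) * (rho^-1)%:E @[rho --> +oo%R]).

Definition argmin f : set V := [set y | forall y', f y <= f y'].

Definition subdiff_monotone_wrt f (Sigma : V -> V) : Prop :=
  forall y y' v v', subdiff f y v -> subdiff f y' v' ->
    (opnorm Sigma (y - y') ^+ 2 <= inner (v - v') (y - y'))%R.

(* L stands for A^* or B^*, and P for the proximal operator S or T. *)
Definition recession_pos_mod_constancy (X : euclideanType R)
    f (L : V -> X) (P : V -> V) : Prop :=
  forall y, L y = 0%R -> P y = 0%R ->
    ~ (recession f (- y)%R = - recession f y /\ - recession f y = 0) ->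
    0 < recession f y.

Definition recession_pos (X : euclideanType R)
    f (L : V -> X) (P : V -> V) : Prop :=
  forall y, y != 0%R -> L y = 0%R -> P y = 0%R -> 0 < recession f y.

End ConvexAnalysis.

Section Problem.
Context {R : realType} {X Y Z : euclideanType R}.
Variables (f : Y -> \bar R) (g : Z -> \bar R).
Variables (A : X -> Y) (As : Y -> X) (B : X -> Z) (Bs : Z -> X) (c : X).

Definition primal_value : \bar R :=
  ereal_inf [set (f p.1 + g p.2)%E | p in [set p : Y * Z | As p.1 + Bs p.2 = c]].

Definition dual_objective (x : X) : \bar R :=
  (- conjugate f (- A x)%R - conjugate g (- B x)%R - (inner c x)%:E)%E.

Definition dual_solution : set X :=
  [set x | forall x', (dual_objective x' <= dual_objective x)%E].

Definition kkt : set (X * Y * Z) :=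
  [set p | let: (x, y, z) := p in
    [/\ subdiff f y (- A x), subdiff g z (- B x) & As y + Bs z = c]].

Variable sigma : R.

Definition aug_lagrangian (y : Y) (z : Z) (x : X) : \bar R :=
  (f y + g z + (inner x (As y + Bs z - c)%R)%:E
   + (sigma / 2 * `|As y + Bs z - c| ^+ 2)%R%:E)%E.

Variables (S : Y -> Y) (T : Z -> Z).

Definition y_objective (xk : X) (yk : Y) (zk : Z) (y : Y) : \bar R :=
  (aug_lagrangian y zk xk + (2^-1 * opnorm S (y - yk) ^+ 2)%R%:E)%E.

Definition z_objective (xk : X) (y' : Y) (zk : Z) (z : Z) : \bar R :=
  (aug_lagrangian y' z xk + (2^-1 * opnorm T (z - zk) ^+ 2)%R%:E)%E.

Variable tau : R.

Definition spadmm (x : nat -> X) (y : nat -> Y) (z : nat -> Z) : Prop :=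
  forall k,
    [/\ argmin (y_objective (x k) (y k) (z k)) (y k.+1),
        argmin (z_objective (x k) (y k.+1) (z k)) (z k.+1) &
        x k.+1 = x k + (tau * sigma) *: (As (y k.+1) + Bs (z k.+1) - c)].

End Problem.

(* Main.v *)
(** Both subproblems minimize [f + quadratic]; a minimizer exists because
    minimal-norm points of decreasing sublevel sets can only escape along a
    recession direction, and by Assumptions 1 and 2 such a direction is one of
    constancy, along which the norm could be decreased.

    For the iterates, monotonicity of the subdifferentials gives a Lyapunov
    inequality around any KKT point. When tau is below the golden ratio it makes
    the primal residuals square-summable; otherwise this is the extra
    hypothesis. In both cases the Lyapunov function is then quasi-Fejer
    monotone: it converges and the increments vanish. The primal iterates may
    be unbounded, so a limit point of [x k] is combined with the primal part of
    a fixed KKT point: it is again a multiplier, and Opial's argument yields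
    convergence of [x k]. *)

(* The obstacle in the descent estimate is the cross term between the new residual and
   [Bs (z k.+2 - z k.+1)]. Monotonicity of the subdifferential of [g] at two consecutive iterates
   trades the new residual for [1 - tau] times the old one, at the price of a telescoping [T]-term;
   this is why the energy exceeds the Lyapunov function by such a term. For [tau > 1], Young's
   inequality with weight [tau^-1] then leaves coefficients proportional to [1 + tau - tau ^+ 2],
   which is positive exactly below the golden ratio.

   The estimates control [y] and [z] only through seminorms attached to [S], [T], [As] and [Bs].
   Inner products with a possibly unbounded factor are therefore handled by Cauchy-Schwarz in the
   matching seminorm, and at a dual limit point it is the sum of the two subgradient inequalities
   that passes to the limit. *)
Require Import Defs.
From mathcomp Require Import all_boot all_order all_algebra.
From mathcomp Require Import all_classical all_reals all_analysis.
From mathcomp Require Import ring lra.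

Set Implicit Arguments.
Unset Strict Implicit.
Unset Printing Implicit Defensive.

Import Order.TTheory GRing.Theory Num.Theory.
Import numFieldNormedType.Exports.
Import VectorInternalTheory.

Local Open Scope classical_set_scope.
Local Open Scope ring_scope.

(** * Euclidean spaces *)

Section EuclideanSpace.
Context {R : realType} {V : euclideanType R}.
Implicit Types (u v w : V) (a : R).

Lemma innerC u v : inner u v = inner v u.
Proof. by rewrite /inner hermC expr0 mul1r. Qed.

Lemma innerDr u v w : inner u (v + w) = inner u v + inner u w.
Proof. by rewrite /inner linearDr. Qed.

Lemma innerDl u v w : inner (u + v) w = inner u w + inner v w.
Proof. by rewrite !(innerC _ w) innerDr. Qed.

Lemma innerNr u v : inner u (- v) = - inner u v.
Proof. by rewrite /inner linearNr. Qed.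

Lemma innerNl u v : inner (- u) v = - inner u v.
Proof. by rewrite !(innerC _ v) innerNr. Qed.

Lemma innerBr u v w : inner u (v - w) = inner u v - inner u w.
Proof. by rewrite innerDr innerNr. Qed.

Lemma innerBl u v w : inner (u - v) w = inner u w - inner v w.
Proof. by rewrite innerDl innerNl. Qed.

Lemma innerZr a u v : inner u (a *: v) = a * inner u v.
Proof. by rewrite /inner linearZr_LR. Qed.

Lemma innerZl a u v : inner (a *: u) v = a * inner u v.
Proof. by rewrite !(innerC _ v) innerZr. Qed.

Lemma inner0r u : inner u 0 = 0.
Proof. by rewrite -(scale0r (0 : V)) innerZr mul0r. Qed.

Lemma inner0l u : inner 0 u = 0.
Proof. by rewrite innerC inner0r. Qed.

Lemma inner_ge0 u : 0 <= inner u u.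
Proof.
have [->|u0] := eqVneq u 0; first by rewrite inner0l.
by rewrite ltW// /inner neq0_dnorm_gt0.
Qed.

Lemma sqr_normE u : `|u| ^+ 2 = inner u u.
Proof. by rewrite euclid_normE sqr_sqrtr// inner_ge0. Qed.

Definition innerE := (innerDl, innerDr, innerNl, innerNr, innerZl, innerZr).

Lemma sqr_opnorm (O : V -> V) u : psd O -> opnorm O u ^+ 2 = inner u (O u).
Proof. by move=> [_ O0]; rewrite sqr_sqrtr. Qed.

Lemma opnorm_ge0 (O : V -> V) u : 0 <= opnorm O u.
Proof. exact: sqrtr_ge0. Qed.

Lemma opnorm_cauchy_schwarz (O : {linear V -> V}) u v : psd O ->
  `|inner u (O v)| <= opnorm O u * opnorm O v.
Proof.
move=> hO; have [sO pO] := hO.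
rewrite -(@ler_pXn2r _ 2)// ?nnegrE ?mulr_ge0 ?opnorm_ge0//.
rewrite exprMn !sqr_opnorm// real_normK ?num_real//.
set a := inner u (O u); set b := inner u (O v); set d := inner v (O v).
have q (s t : R) : 0 <= s ^+ 2 * a + 2 * s * t * b + t ^+ 2 * d.
  have := pO (s *: u + t *: v).
  rewrite linearD !linearZ/= !innerE -(sO v u) (innerC (O v)) -/a -/b -/d.
  by move=> ?; lra.
have a0 : 0 <= a by exact: pO.
have d0 : 0 <= d by exact: pO.
(* The weights [(d, - b)] give [d (a d - b^2) >= 0]. In the degenerate case [d = 0], the weights
   [(b, - (a + 1))] give [- (a + 2) b^2 >= 0], hence [b = 0]. *)
have [dp|] := ltP 0 d.
  have := q d (- b); rewrite (_ : _ + _ = d * (a * d - b ^+ 2)); last by ring.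
  by rewrite pmulr_rge0// subr_ge0.
move=> dn; have de : d = 0 by apply/eqP; rewrite eq_le dn d0.
have := q b (- (a + 1)); rewrite de mulr0 addr0 mulr0.
have := sqr_ge0 b; nra.
Qed.

Lemma cauchy_schwarz u v : `|inner u v| <= `|u| * `|v|.
Proof.
have hid : psd (idfun : V -> V) by split=> // w; exact: inner_ge0.
have := opnorm_cauchy_schwarz u v hid.
by rewrite /opnorm /= -!euclid_normE.
Qed.

End EuclideanSpace.

(** * Subsequences and cluster points *)

Section Subsequences.
Context {R : realType}.

(** Subsequences are encoded as index maps with [n <= phi n], a condition that countable choice
    delivers directly and that composition preserves. *)
Lemma subseq_cvg_oo (phi : nat -> nat) :
  (forall n, (n <= phi n)%N) -> phi n @[n --> \oo] --> \oo.
Proof.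
move=> hphi A [N _ NA]; exists N => // n /= Nn.
by apply: NA => /=; rewrite (leq_trans Nn).
Qed.

Lemma cluster_subseq (T : pseudoMetricType R) (u : nat -> T) (p : T) :
  cluster (u n @[n --> \oo]) p ->
  exists2 phi : nat -> nat, (forall n, (n <= phi n)%N) &
    u (phi n) @[n --> \oo] --> p.
Proof.
move=> up.
have ex n : exists k, (n <= k)%N /\ ball p n.+1%:R^-1 (u k).
  have e0 : 0 < n.+1%:R^-1 :> R by rewrite invr_gt0.
  have [||x [[k nk <-] xp]] := up (u @` [set k | (n <= k)%N]) (ball p n.+1%:R^-1).
  - by exists n => // k /= nk; exists k.
  - exact: nbhsx_ballx.
  - by exists k.
have [phi hphi] := choice ex.
exists phi => [n|]; first by have [] := hphi n.
apply/cvg_ballP => e e0.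
near=> n; have [_] := hphi n; apply: le_ball.
by apply/ltW; near: n; exact: (near_infty_natSinv_lt (PosNum e0)).
Unshelve. all: by end_near. Qed.

End Subsequences.

(** * Coordinates, compactness and bounded linear maps *)

Section FiniteDimension.
Context {R : realType}.

Lemma r2v_continuous (V : euclideanType R) :
  continuous (r2v : 'rV[R]_(dim V) -> V).
Proof.
have -> : (r2v : 'rV[R]_(dim V) -> V) =
    fun w => \sum_(i < dim V) w ord0 i *: r2v (delta_mx ord0 i).
  apply/funext => w; rewrite {1}(row_sum_delta w) linear_sum.
  by apply: eq_bigr => i _; rewrite linearZ.
apply: continuous_big => [|i _ w]; first exact: add_continuous.
exact: (cvgZr_tmp (@coord_continuous R 1 (dim V) ord0 i w)).
Qed.

(** Half of the equivalence of norms: [w |-> |r2v w|] is continuous and nonzero on the compact unit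
    sphere of row vectors, so it stays above some [e > 0] there, and [e^-1] is the constant. *)
Lemma v2r_bounded (V : euclideanType R) :
  exists2 C : R, 0 < C & forall v : V, `|v2r v| <= C * `|v|.
Proof.
pose S := [set w : 'rV[R]_(dim V) | `|w| = 1].
have cS : compact S.
  apply: bounded_closed_compact.
    exists 1; split; first exact: num_real.
    by move=> M M1 w /= ->; exact: ltW.
  apply: (@preimage_closed _ R (fun w : 'rV[R]_(dim V) => `|w|) [set x | x = 1]) => [w _|].
    exact: norm_continuous.
  exact: closed_eq.
pose h (w : 'rV[R]_(dim V)) : R := `|r2v w : V|.
have hc : continuous h.
  by move=> w; apply: continuous_comp; [exact: r2v_continuous|exact: norm_continuous].
have cK : compact (h @` S).
  by apply: continuous_compact => //; exact: continuous_subspaceT.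
have clK : closed (h @` S) by apply: compact_closed.
have nK : (~` (h @` S)) 0.
  move=> [w /= w1 /eqP]; rewrite normr_eq0 => /eqP w0.
  have wz : w = 0 by rewrite -(r2vK w) w0 linear0.
  by move: (oner_eq0 R); rewrite -w1 wz => /eqP; apply; exact: normr0.
have /nbhs_ballP[e /= e0 eK] : nbhs (0 : R) (~` (h @` S)).
  by apply: open_nbhs_nbhs; split => //; exact: closed_openC.
exists e^-1; first by rewrite invr_gt0.
move=> v; have [->|v0] := eqVneq v 0; first by rewrite linear0 !normr0 mulr0.
have w0 : 0 < `|v2r v|.
  rewrite normr_gt0; apply: contraNneq v0 => w0.
  by rewrite -(v2rK v) w0 linear0.
rewrite mulrC ler_pdivlMr// leNgt; apply/negP => ve.
have := eK (`|v2r v|^-1 * `|v|); apply.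
  rewrite /ball/= sub0r normrN ger0_norm ?mulr_ge0 ?invr_ge0//.
  by rewrite mulrC ltr_pdivrMr// mulrC.
exists (`|v2r v|^-1 *: v2r v).
  by rewrite /S/= normrZ normfV normr_id mulVf// gt_eqF.
by rewrite /h linearZ/= v2rK normrZ normfV normr_id.
Qed.

Lemma linear_map_bounded (V W : euclideanType R) (L : {linear V -> W}) :
  exists2 C : R, 0 <= C & forall v, `|L v| <= C * `|v|.
Proof.
have [C C0 hC] := v2r_bounded V.
pose D := \sum_(i < dim V) `|L (r2v (delta_mx ord0 i))|.
have D0 : 0 <= D by apply: sumr_ge0.
exists (C * D); first by rewrite mulr_ge0// ltW.
move=> v; rewrite -{1}(v2rK v) (row_sum_delta (v2r v)) !linear_sum.
rewrite (le_trans (ler_norm_sum _ _ _))// mulrAC /D mulr_sumr.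
apply: ler_sum => i _; rewrite !linearZ/= normrZ ler_wpM2r//.
by rewrite (le_trans _ (hC v))// [leRHS]/Num.norm/= mx_normrE;
  apply: (le_bigmax _ (fun ij => `|v2r v ij.1 ij.2|) (ord0, i)).
Qed.

Lemma linear_map_continuous (V W : euclideanType R) (L : {linear V -> W}) :
  continuous L.
Proof.
have [C C0 hC] := linear_map_bounded L.
apply: bounded_linear_continuous; apply/linear_boundedP.
exists C; split; first exact: num_real.
by move=> x Cx v; rewrite (le_trans (hC v))// ler_wpM2r// ltW.
Qed.

(** Bolzano-Weierstrass: boundedness is transported to row vectors, whose closed balls are compact,
    and the cluster point is brought back by [r2v]. *)
Lemma bounded_subseq (V : euclideanType R) (u : nat -> V) (M : R) :
  (forall n, `|u n| <= M) ->
  exists phi : nat -> nat, exists2 p : V, (forall n, (n <= phi n)%N) &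
    u (phi n) @[n --> \oo] --> p.
Proof.
move=> uM; have [C C0 hC] := v2r_bounded V.
pose K := [set w : 'rV[R]_(dim V) | `|w| <= C * M].
have cK : compact K.
  apply: bounded_closed_compact.
    exists (C * M); split; first exact: num_real.
    by move=> N MN w /= wM; rewrite (le_trans wM)// ltW.
  apply: (@preimage_closed _ R (fun w : 'rV[R]_(dim V) => `|w|) [set x | x <= C * M]) => [w _|].
    exact: norm_continuous.
  exact: closed_le.
have [|p [Kp up]] := cK (v2r (u n) @[n --> \oo]).
  exists 0%N => // n _; apply: (le_trans (hC _)).
  by rewrite ler_wpM2l// ltW.
have [phi hphi vp] := cluster_subseq up.
exists phi, (r2v p) => //.
have : r2v (v2r (u (phi n))) @[n --> \oo] --> (r2v p : V).
  exact: (continuous_cvg _ (@r2v_continuous V p) vp).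
by under eq_fun do rewrite v2rK.
Qed.

End FiniteDimension.

Section EuclideanLimits.
Context {R : realType} {V : euclideanType R}.
Implicit Types (u : nat -> V).

Lemma inner_cvg T (F : set_system T) (FF : Filter F) (u v : T -> V) (p q : V) :
  u n @[n --> F] --> p -> v n @[n --> F] --> q ->
  inner (u n) (v n) @[n --> F] --> inner p q.
Proof.
have polar (a b : V) : inner a b = 4^-1 * (`|a + b| ^+ 2 - `|a - b| ^+ 2).
  rewrite !sqr_normE !innerE (innerC b a); lra.
move=> up vq; rewrite polar; under eq_fun do rewrite polar.
apply: cvgM; first exact: cvg_cst.
by apply: cvgB; rewrite !expr2; apply: cvgM; apply: cvg_norm;
  (exact: cvgD || exact: cvgB).
Qed.

(** Cauchy-Schwarz for the form of [O], applied to [w] and [O w], bounds [|O w| ^+ 2], and one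
    factor [|O w|] cancels. A vanishing or bounded seminorm thus yields a vanishing or bounded
    image. *)
Lemma psd_bounded (O : {linear V -> V}) : psd O ->
  exists2 C : R, 0 <= C & forall w, `|O w| <= C * opnorm O w.
Proof.
move=> hO; have [C C0 hC] := linear_map_bounded O.
exists (Num.sqrt C) => [|w]; first exact: sqrtr_ge0.
have [->|Ow0] := eqVneq (O w) 0; first by rewrite normr0 mulr_ge0 ?sqrtr_ge0.
have Owp : 0 < `|O w| by rewrite normr_gt0.
have h1 : `|O w| ^+ 2 <= opnorm O w * opnorm O (O w).
  by rewrite sqr_normE hO.1 (le_trans (ler_norm _))// opnorm_cauchy_schwarz.
have h2 : opnorm O (O w) <= Num.sqrt C * `|O w|.
  rewrite -[leRHS]ger0_norm ?mulr_ge0 ?sqrtr_ge0// -sqrtr_sqr ler_wsqrtr//.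
  rewrite exprMn sqr_sqrtr// (le_trans (ler_norm _))//.
  rewrite (le_trans (cauchy_schwarz _ _))// expr2 mulrCA ler_wpM2l//.
rewrite -(ler_pM2r Owp) -expr2 (le_trans h1)//.
by rewrite mulrAC [leRHS]mulrC ler_wpM2l// opnorm_ge0.
Qed.

Lemma psd_eq0 (O : {linear V -> V}) (w : V) : psd O -> inner w (O w) = 0 ->
  O w = 0.
Proof.
move=> hO w0; have [C C0 /(_ w)] := psd_bounded hO.
by rewrite /opnorm w0 sqrtr0 mulr0 normr_le0 => /eqP.
Qed.

(* Normalizing an unbounded sequence and using compactness of the unit
   sphere. *)
Lemma unbounded_direction u : ~ (exists M : R, forall n, `|u n| <= M) ->
  exists psi : nat -> nat, exists2 d : V, `|d| = 1 &
    `|u (psi n)|^-1 @[n --> \oo] --> 0 /\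
    `|u (psi n)|^-1 *: u (psi n) @[n --> \oo] --> d.
Proof.
move=> nb.
have ex n : exists k, n.+1%:R < `|u k|.
  apply: contrapT => h; apply: nb; exists n.+1%:R => k.
  by rewrite leNgt; apply/negP => nk; apply: h; exists k.
have [psi hpsi] := choice ex.
have psi0 n : 0 < `|u (psi n)| by rewrite (lt_trans _ (hpsi n)).
have [|phi [d hphi dphi]] :=
    @bounded_subseq _ _ (fun n => `|u (psi n)|^-1 *: u (psi n)) 1.
  by move=> n; rewrite normrZ normfV normr_id mulVf// gt_eqF.
exists (psi \o phi), d => /=.
  have : `| `|u (psi (phi n))|^-1 *: u (psi (phi n))| @[n --> \oo] --> `|d|.
    by apply: cvg_norm; exact: dphi.
  under eq_fun do rewrite normrZ normfV normr_id mulVf ?gt_eqF//.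
  by move/cvg_lim => <- //; exact: lim_cst.
split => //.
apply: (@squeeze_cvgr _ _ _ _ (fun=> 0) (fun n => n.+1%:R^-1)).
- near=> n; rewrite invr_ge0 normr_ge0/= lef_pV2 ?posrE//.
  by rewrite ltW// (le_lt_trans _ (hpsi _))// ler_nat ltnS.
- exact: cvg_cst.
- exact: cvg_harmonic.
Unshelve. all: by end_near. Qed.

End EuclideanLimits.

(** * Recession directions and attainment *)

Section ConvexFunctions.
Context {R : realType} {V : euclideanType R}.
Implicit Types (f : V -> \bar R) (p u : V).

Lemma proper_fin f p : Defs.proper f -> dom f p -> f p = (fine (f p))%:E.
Proof.
move=> [fN _] fp; rewrite fineK// fin_numE gt_eqF ?fN//= lt_eqF//.
Qed.

Lemma lsc_cvg_le f (y : nat -> V) (b : nat -> R) p (l : R) :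
  lower_semicontinuous f -> y n @[n --> \oo] --> p -> b n @[n --> \oo] --> l ->
  (\forall n \near \oo, (f (y n) <= (b n)%:E)%E) -> (f p <= l%:E)%E.
Proof.
move=> lf yp bl fyb; rewrite leNgt; apply/negP => lfp.
have [a [la afp]] : exists a : R, l < a /\ (a%:E < f p)%E.
  case: (f p) lfp => [r|_|//].
    rewrite lte_fin => lr; exists ((l + r) / 2).
    by rewrite lte_fin; split; rewrite ?midf_lt.
  by exists (l + 1); rewrite ltry ltrDl.
have [A Ap hA] := lf _ _ afp.
have near_a : \forall n \near \oo, a <= b n.
  near=> n.
  rewrite -lee_fin; apply: (@le_trans _ _ (f (y n))); last by near: n.
  by apply/ltW/hA; near: n; exact: yp.
have : a <= l.
  exact: (cvgr_to_ge bl).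
by rewrite leNgt la.
Unshelve. all: by end_near. Qed.

Lemma lsc_cvg_le_cst f (y : nat -> V) p (a : \bar R) : (-oo < a)%E ->
  lower_semicontinuous f -> y n @[n --> \oo] --> p ->
  (\forall n \near \oo, (f (y n) <= a)%E) -> (f p <= a)%E.
Proof.
case: a => [a _|_|//]; last by rewrite leey.
by move=> lf yp fya; apply: (lsc_cvg_le lf yp (cvg_cst _) fya).
Qed.

(** The convex combinations of [y n] and [p] with weight [rho * t n] tend to [p + rho *: u], while
    convexity bounds their values by a sequence tending to [f p]; lower semicontinuity concludes,
    for every base point [p]. *)
Lemma recession_direction f (y : nat -> V) (t : nat -> R) (M : R) u :
  closed_proper_convex f -> (forall n, 0 <= t n) ->
  t n @[n --> \oo] --> 0 -> t n *: y n @[n --> \oo] --> u ->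
  (forall n, (f (y n) <= M%:E)%E) ->
  forall p, dom f p -> forall rho : R, 0 <= rho -> (f (p + rho *: u)%R <= f p)%E.
Proof.
move=> [lf pf cf] t0 tz tyu fM p fp rho rho0.
have fpE := proper_fin pf fp; set a := fine (f p) in fpE.
rewrite fpE.
have rtz : rho * t n @[n --> \oo] --> 0.
  by rewrite -[X in _ --> X](mulr0 rho); apply: cvgM => //; exact: cvg_cst.
apply: (@lsc_cvg_le _ (fun n => (rho * t n) *: y n + (1 - rho * t n) *: p)
         (fun n => (rho * t n) * M + (1 - rho * t n) * a)) => //.
- rewrite addrC; apply: cvgD.
    under eq_fun do rewrite -scalerA.
    exact: (@cvgZl_tmp _ _ _ _ _ rho _ _ tyu).
  rewrite -[X in _ --> X]scale1r; apply: cvgZr_tmp.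
  by rewrite -[X in _ --> X]subr0; apply: cvgB => //; exact: cvg_cst.
- rewrite -[X in _ --> X]add0r; apply: cvgD.
    by rewrite -[X in _ --> X](mul0r M); apply: cvgM => //; exact: cvg_cst.
  rewrite -[X in _ --> X]mul1r; apply: cvgM; last exact: cvg_cst.
  by rewrite -[X in _ --> X]subr0; apply: cvgB => //; exact: cvg_cst.
- near=> n.
  have rt1 : 0 <= rho * t n <= 1.
    rewrite mulr_ge0//=; near: n.
    by near=> n; rewrite ltW//; near: n; exact: (cvgr_lt _ rtz).
  rewrite (le_trans (cf _ _ _ rt1))// fpE !EFinD !EFinM leeD2r//.
  by rewrite lee_wpmul2l// lee_fin; case/andP: rt1.
Unshelve. all: by end_near. Qed.

Lemma dom_xget f : Defs.proper f -> dom f (xget 0 (dom f)).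
Proof. by move=> [_ [p fp]]; exact: (xgetI 0 fp). Qed.

Definition diff_quotient f p u (rho : R) : \bar R :=
  ((f (p + rho *: u)%R - f p) * (rho^-1)%:E)%E.

Lemma diff_quotient_le f p u (r s : R) : Defs.proper f -> Defs.convex f -> dom f p ->
  0 < r -> r <= s -> (diff_quotient f p u r <= diff_quotient f p u s)%E.
Proof.
move=> pf cf fp r0 rs; have s0 := lt_le_trans r0 rs.
rewrite /diff_quotient; have fpE := proper_fin pf fp; set a := fine _ in fpE.
have rs1 : 0 <= r / s <= 1 by rewrite divr_ge0 ?(ltW s0) ?(ltW r0)//= ler_pdivrMr ?mul1r.
have := cf _ (p + s *: u) p rs1.
have -> : (r / s) *: (p + s *: u) + (1 - r / s) *: p = p + r *: u.
  by rewrite scalerDr scalerA mulfVK ?gt_eqF// scalerBl scale1r addrAC [X in X + _]addrC subrK.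
rewrite fpE.
have : (-oo < f (p + r *: u)%R)%E by exact: pf.1.
have : (-oo < f (p + s *: u)%R)%E by exact: pf.1.
case: (f (p + s *: u)) => [x||] // _; last first.
  by rewrite /= gt0_mulye ?lte_fin ?invr_gt0// leey.
case: (f (p + r *: u)) => [y||] // _.
  rewrite -!EFinB -!EFinM -EFinD !lee_fin => h.
  rewrite ler_pdivrMr// mulrAC -mulrA.
  by move: h; rewrite [1 - _]addrC mulrDl mul1r mulNr; lra.
Qed.

Lemma diff_quotient_is_cvg f p u : Defs.proper f -> Defs.convex f -> dom f p ->
  cvg (diff_quotient f p u rho @[rho --> +oo]).
Proof.
move=> pf cf fp.
(* The quotient is monotone for positive [rho] only; the value [-oo] elsewhere makes it monotone on
   the whole line without changing the limit. *)
pose q rho := if 0 < rho then diff_quotient f p u rho else -oo%E.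
have : cvg (q rho @[rho --> +oo]).
  apply: nondecreasing_is_cvge => r s rs; rewrite /q.
  case: ifPn => [r0|_]; last by rewrite leNye.
  by rewrite (lt_le_trans r0 rs); exact: diff_quotient_le.
move=> /cvg_ex[l ql]; apply/cvg_ex; exists l.
apply: cvg_trans ql; apply: near_eq_cvg.
by near=> rho; rewrite /q; suff -> : 0 < rho by []; near: rho; exact: nbhs_pinfty_gt.
Unshelve. all: by end_near. Qed.

(** The difference quotients increase to their limit, so the limit is nonpositive exactly when each
    of them is. The base point is the one chosen in [recession]. *)
Lemma recession_le0P f u : closed_proper_convex f ->
  (recession f u <= 0)%E <->
  (forall rho : R, 0 <= rho ->
     (f (xget 0 (dom f) + rho *: u)%R <= f (xget 0%R (dom f)))%E).
Proof.
move=> [lf pf cf]; set p : V := xget 0 (dom f).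
have fp : dom f p := dom_xget pf.
have fpE := proper_fin pf fp.
have cq := @diff_quotient_is_cvg f p u pf cf fp.
have recE : recession f u = lim (diff_quotient f p u rho @[rho --> +oo]) by [].
split=> [rec0 rho|h].
  rewrite le_eqVlt => /predU1P[<-|rho0]; first by rewrite scale0r addr0.
  have : (diff_quotient f p u rho <= 0)%E.
    apply: le_trans rec0; rewrite recE; apply: lime_ge => //.
    apply: (filterS _ (nbhs_pinfty_ge (num_real rho))) => s rs.
    exact: diff_quotient_le.
  rewrite /diff_quotient muleC pmule_rle0 ?lte_fin ?invr_gt0// fpE.
  by rewrite sube_le0.
rewrite recE; apply: lime_le => //.
apply: (filterS _ (nbhs_pinfty_gt (num_real 0))) => rho rho0.
rewrite /diff_quotient muleC pmule_rle0 ?lte_fin ?invr_gt0//.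
by rewrite fpE sube_le0 -fpE; apply: h; exact: ltW.
Qed.

(** Independence of the base point: the ray from the chosen point, sampled at [n.+1] and rescaled by
    [n.+1%:R^-1], has direction [u] in the sense of [recession_direction]. *)
Lemma recession_le0_dom f u : closed_proper_convex f ->
  (recession f u <= 0)%E ->
  forall p, dom f p -> forall rho : R, 0 <= rho -> (f (p + rho *: u)%R <= f p)%E.
Proof.
move=> hf /(recession_le0P _ hf); have [lf pf cf] := hf.
set u0 := xget 0 (dom f) => h.
have u0E := proper_fin pf (dom_xget pf : dom f u0).
apply: (@recession_direction f (fun n => u0 + n.+1%:R *: u)
  (fun n => n.+1%:R^-1) (fine (f u0))) => //.

- exact: cvg_harmonic.
- have h0 : n.+1%:R^-1 *: u0 + u @[n --> \oo] --> (0 : R) *: u0 + u.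
    by apply: cvgD; [apply: cvgZr_tmp; exact: cvg_harmonic|exact: cvg_cst].
  under eq_fun do rewrite scalerDr scalerA mulVf// scale1r.
  by rewrite scale0r add0r in h0.
- by move=> n; rewrite -u0E; exact: h.
Qed.

Lemma recession_le0_of_dom f u : closed_proper_convex f ->
  (forall p, dom f p -> forall rho : R, 0 <= rho -> (f (p + rho *: u)%R <= f p)%E) ->
  (recession f u <= 0)%E.
Proof.
move=> hf h; apply/(recession_le0P _ hf) => rho rho0; apply: h => //.
by apply: dom_xget; case: hf.
Qed.

End ConvexFunctions.

(** * Existence of minimizers *)

Section Attainment.
Context {R : realType} {V : euclideanType R}.
Implicit Types (h : V -> \bar R) (b p u : V).

Lemma min_norm_sublevel h b : closed_proper_convex h ->
  exists2 y, (h y <= h b)%E & forall w, (h w <= h b)%E -> `|y| <= `|w|.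
Proof.
move=> [lh ph _].
pose S := [set `|w| | w in [set w | (h w <= h b)%E]].
have Sinf : has_inf S.
  split; first by exists `|b|, b => /=.
  by exists 0 => _ [w _ <-].
have ex n : exists w, (h w <= h b)%E /\ `|w| < inf S + n.+1%:R^-1.
  have n0 : 0 < n.+1%:R^-1 :> R by rewrite invr_gt0.
  by have [_ [w hw <-] wS] := inf_adherent n0 Sinf; exists w.
have [w hw] := choice ex.
have [|phi [p hphi wp]] := @bounded_subseq _ _ w (inf S + 1).
  move=> n; rewrite (le_trans (ltW (hw n).2))// lerD2l invf_le1 ?ler1n//.
exists p.
  apply: (lsc_cvg_le_cst (ph.1 b) lh wp); near=> n; exact: (hw _).1.
move=> v hv; have Sv : inf S <= `|v| by apply: ge_inf; [exact: Sinf.2|exists v].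
apply: le_trans Sv.
have np : `|w (phi n)| @[n --> \oo] --> `|p| by apply: cvg_norm; exact: wp.
have nS : inf S + n.+1%:R^-1 @[n --> \oo] --> inf S.
  by rewrite -[X in _ --> X]addr0; apply: cvgD; [exact: cvg_cst|exact: cvg_harmonic].
apply: (ler_cvg_to np nS); near=> n.
rewrite (le_trans (ltW (hw _).2))// lerD2l lef_pV2 ?posrE//.
by rewrite ler_nat ltnS.
Unshelve. all: by end_near. Qed.

(* Minimal-norm points of ever lower sublevel sets stay bounded: otherwise
   their directions accumulate at a unit recession direction [u], moving back
   along [u] stays in the sublevel set and decreases the norm. *)
Lemma argmin_nonempty h : closed_proper_convex h ->
  (forall u,
    (forall p, dom h p -> forall rho : R, 0 <= rho -> (h (p + rho *: u)%R <= h p)%E) ->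
    (forall p, dom h p -> forall rho : R, 0 <= rho -> (h (p - rho *: u)%R <= h p)%E)) ->
  argmin h !=set0.
Proof.
move=> hh hdir; have [lh ph ch] := hh.
apply: contrapT => nmin.
have [p0 hp0] := ph.2.
have hlt x : (ereal_inf (range h) < h x)%E.
  rewrite ltNge; apply/negP => hx; apply: nmin; exists x => y.
  by apply: le_trans hx _; apply: ereal_inf_lbound; exists y.
have [|s sr sinf] := @ereal_inf_seq _ (range h).
  by apply/set0P; exists (h p0), p0.
have sex n : exists b, h b = s n by have [b _ <-] := sr n; exists b.
have [b hb] := choice sex.
(* Capping the minimizing sequence at the finite level [h p0] provides the uniform bound required by
   [recession_direction]. *)
pose c n := if (h (b n) <= h p0)%E then b n else p0.
have c0 n : (h (c n) <= h p0)%E by rewrite /c; case: ifP.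
have b_lt x : \forall n \near \oo, (h (b n) < h x)%E.
  under eq_near do rewrite hb.
  by exact: (sinf _ (open_ereal_lt' (hlt x))).
have c_lt x : \forall n \near \oo, (h (c n) < h x)%E.
  near=> n; rewrite /c ifT; first by near: n; exact: b_lt.
  by apply: ltW; near: n; exact: b_lt.
have yex n : exists y, (h y <= h (c n))%E /\
    forall w, (h w <= h (c n))%E -> `|y| <= `|w|.
  by have [y y1 y2] := min_norm_sublevel (c n) hh; exists y.
have [y hy] := choice yex.
have [[M yM]|nb] := pselect (exists M : R, forall n, `|y n| <= M).
  have [phi [p hphi yp]] := bounded_subseq yM.
  apply: nmin; exists p => x; apply: (lsc_cvg_le_cst (ph.1 x) lh yp).
  near=> n; rewrite (le_trans (hy _).1)// ltW//.
  by near: n; exact: (subseq_cvg_oo hphi (c_lt x)).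
have [psi [u u1 [tz tyu]]] := unbounded_direction nb.
have hp0E := proper_fin ph hp0.
have rec : forall p, dom h p -> forall rho : R, 0 <= rho ->
    (h (p - rho *: u)%R <= h p)%E.
  apply: hdir; apply: (recession_direction (M := fine (h p0)) hh _ tz tyu).
    by move=> n; rewrite invr_ge0.
  by move=> n; rewrite -hp0E (le_trans (hy _).1).
have uu1 : inner u u = 1 by rewrite -sqr_normE u1 expr1n.
have yu n : inner (y (psi n)) u <= 0.
  set yn := y _; have ydom : dom h yn.
    by rewrite /dom/= (le_lt_trans (hy _).1)// (le_lt_trans (c0 _)).
  (* Minimality of [|yn|] against [yn - rho *: u], expanded with [|u| = 1]. Taking [rho] equal to
     [inner yn u] excludes a positive inner product, whereas the normalized [yn] tend to [u]. *)
  have le2 (rho : R) : 0 < rho -> 2 * inner yn u <= rho.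
    move=> rho0; have : `|yn| <= `|yn - rho *: u|.
      by apply: (hy _).2; rewrite (le_trans (rec _ ydom _ (ltW rho0)))// (hy _).1.
    rewrite -(@ler_pXn2r _ 2) ?nnegrE// !sqr_normE !innerE uu1.
    by rewrite (innerC u); nra.
  by rewrite leNgt; apply/negP => yu0; have := le2 _ yu0; lra.
have : inner u u <= 0.
  have uu : inner (`|y (psi n)|^-1 *: y (psi n)) u @[n --> \oo] --> inner u u.
    by apply: inner_cvg => //; exact: cvg_cst.
  apply: (cvgr_to_le uu); near=> n; rewrite innerZl mulr_ge0_le0// ?invr_ge0//.
by rewrite uu1 ler10.
Unshelve. all: by end_near. Qed.

End Attainment.

(** * The proximal subproblem *)

Section ProximalSubproblem.
Context {R : realType} {X V : euclideanType R}.
Variables (f : V -> \bar R) (Ls : {linear X -> V}) (L : {linear V -> X}).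
Variables (P : {linear V -> V}) (sigma : R).
Hypotheses (hf : closed_proper_convex f) (hL : adjoint Ls L) (hP : psd P).
Hypothesis sigma0 : 0 < sigma.
Implicit Types (x b : X) (v w d u : V) (gamma : R).

Definition prox_quad x b w gamma v : R :=
  gamma + inner x (L v + b) + sigma / 2 * `|L v + b| ^+ 2
  + 2^-1 * opnorm P (v - w) ^+ 2.

Definition prox_objective x b w gamma v : \bar R :=
  (f v + (prox_quad x b w gamma v)%:E)%E.

Definition prox_grad x b w v : V := Ls (x + sigma *: (L v + b)) + P (v - w).

Definition prox_curv d : R := sigma / 2 * `|L d| ^+ 2 + 2^-1 * inner d (P d).

(** The Taylor expansion of a quadratic is exact at order two. Convexity, the optimality condition
    and constancy along the common kernel of [L] and [P] are all read off from it. *)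
Lemma prox_quadD x b w gamma v d :
  prox_quad x b w gamma (v + d) =
  prox_quad x b w gamma v + inner (prox_grad x b w v) d + prox_curv d.
Proof.
rewrite /prox_quad /prox_grad /prox_curv !sqr_opnorm// !sqr_normE.
have -> : L (v + d) + b = (L v + b) + L d by rewrite linearD addrAC.
have -> : v + d - w = (v - w) + d by rewrite addrAC.
move: (v - w) (L v + b) => e z.
rewrite (linearD P) !innerDl !innerDr hL !innerDl !innerZl.
have -> : inner d (P e) = inner e (P d) by rewrite -hP.1 innerC.
rewrite hP.1 (innerC (L d) z); lra.
Qed.

Lemma prox_curv_ge0 d : 0 <= prox_curv d.
Proof.
by rewrite addr_ge0// mulr_ge0// ?exprn_ge0// ?divr_ge0 ?(ltW sigma0)//; exact: hP.2.
Qed.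

Lemma prox_curvZ (t : R) d : prox_curv (t *: d) = t ^+ 2 * prox_curv d.
Proof. by rewrite /prox_curv !linearZ/= !sqr_normE !innerE; lra. Qed.

Lemma prox_curv_eq0 u : prox_curv u = 0 -> L u = 0 /\ P u = 0.
Proof.
rewrite /prox_curv => c0.
have h1 : 0 <= sigma / 2 * `|L u| ^+ 2.
  by rewrite mulr_ge0// ?exprn_ge0// divr_ge0// ltW.
have h2 := hP.2 u.
have Pu : inner u (P u) = 0 by lra.
split; last exact: psd_eq0.
have /eqP : sigma / 2 * `|L u| ^+ 2 = 0 by lra.
by rewrite mulf_eq0 sqrf_eq0 normr_eq0 mulf_eq0 invr_eq0 pnatr_eq0 orbF
  gt_eqF//= => /eqP.
Qed.

Lemma prox_quad_continuous x b w gamma : continuous (prox_quad x b w gamma).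
Proof.
have -> : prox_quad x b w gamma = fun v => gamma + inner x (L v + b) +
    sigma / 2 * inner (L v + b) (L v + b) + 2^-1 * inner (v - w) (P (v - w)).
  by apply/funext => v; rewrite /prox_quad sqr_normE sqr_opnorm.
move=> v.
have cL : L y + b @[y --> v] --> L v + b.
  by apply: cvgD; [exact: linear_map_continuous|exact: cvg_cst].
have cw : y - w @[y --> v] --> v - w by apply: cvgB; [exact: cvg_id|exact: cvg_cst].
have cPw : P (y - w) @[y --> v] --> P (v - w).
  by apply: continuous_cvg => //; exact: linear_map_continuous.
apply: cvgD; last by apply: cvgM; [exact: cvg_cst|exact: inner_cvg].
apply: cvgD; last by apply: cvgM; [exact: cvg_cst|exact: inner_cvg].
apply: cvgD; first exact: cvg_cst.
by apply: inner_cvg => //; exact: cvg_cst.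
Qed.

Lemma prox_quad_convex x b w gamma (t : R) u v : 0 <= t <= 1 ->
  prox_quad x b w gamma (t *: u + (1 - t) *: v) <=
  t * prox_quad x b w gamma u + (1 - t) * prox_quad x b w gamma v.
Proof.
move=> /andP[t0 t1]; set p := t *: u + (1 - t) *: v.
(* Expanding around [p] cancels the linear terms and leaves the convexity defect [t (1 - t)] times
   the curvature of [u - v]. *)
have uE : u = p + (1 - t) *: (u - v).
  by rewrite /p scalerBr addrACA subrr addr0 -scalerDl addrC subrK scale1r.
have vE : v = p + (- t) *: (u - v).
  by rewrite /p scalerBr addrACA -scalerDl subrr scale0r add0r -scalerBl opprK
    subrK scale1r.
have := prox_curv_ge0 (u - v).
have := prox_quadD x b w gamma p ((1 - t) *: (u - v)).
have := prox_quadD x b w gamma p ((- t) *: (u - v)).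
rewrite -uE -vE !prox_curvZ !innerZr => -> ->.
set C := prox_curv _; set G := inner _ _ ; set Q := prox_quad _ _ _ _ _ => C0.
have : 0 <= t * (1 - t) * C by rewrite !mulr_ge0// subr_ge0.
nra.
Qed.

Lemma prox_objective_cpc x b w gamma :
  closed_proper_convex (prox_objective x b w gamma).
Proof.
have [lf pf cf] := hf; split.
- move=> v a; rewrite /prox_objective; set q := prox_quad x b w gamma => afq.
  (* The level [a] is split as [r + (a - r)]: [f] stays above [r] by lower semicontinuity, and [q]
     above [a - r] by continuity. *)
  have [r [ar rf]] : exists r : R, a - q v < r /\ (r%:E < f v)%E.
    have := pf.1 v; case: (f v) afq => [s||//] afq _.
      move: afq; rewrite -EFinD lte_fin => afq.
      exists ((a - q v + s) / 2); rewrite lte_fin.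
      by split; rewrite ?midf_lt// ltrBlDr.
    by exists (a - q v + 1); rewrite ltry ltrDl.
  have [A vA hA] := lf _ _ rf.
  have qv : \forall y \near v, a - r < q y.
    by apply: (cvgr_gt (q v)); [exact: prox_quad_continuous|rewrite ltrBlDr -ltrBlDl].
  exists (A `&` [set y | a - r < q y]); first exact: filterI.
  move=> y [Ay /= ry]; have := hA _ Ay; case: (f y) => [s||//].
    by rewrite -EFinD !lte_fin => rs; lra.
  by move=> _; rewrite addye// ltry.
- split=> [v|].
    rewrite /prox_objective; have := pf.1 v.
    by case: (f v) => [s||//] _; rewrite ?addye// -?EFinD ltNyr.
  have [p fp] := pf.2; exists p; rewrite /dom/= /prox_objective.
  by rewrite (proper_fin pf fp) -EFinD ltry.
- move=> t u v t01; have [t0 t1] := andP t01.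
  have q_fin (y : V) : (prox_quad x b w gamma y)%:E \is a fin_num by [].
  rewrite /prox_objective.
  rewrite muleDr// ?fin_num_adde_defl//.
  rewrite muleDr// ?fin_num_adde_defl//.
  rewrite addeACA leeD//; first exact: cf.
  by rewrite -!EFinM -EFinD lee_fin; exact: prox_quad_convex.
Qed.

Lemma dom_prox x b w gamma v : dom (prox_objective x b w gamma) v <-> dom f v.
Proof.
rewrite /dom/= /prox_objective; have [_ pf _] := hf; have := pf.1 v.
by case: (f v) => [s||//] _; rewrite ?addye// -?EFinD ?ltry.
Qed.

Lemma argmin_prox_subdiff x b w gamma v :
  argmin (prox_objective x b w gamma) v ->
  dom f v /\ subdiff f v (- prox_grad x b w v).
Proof.
have [lf pf cf] := hf; move=> vmin.
have fv : dom f v.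
  have [p fp] := pf.2; apply/(dom_prox x b w gamma).
  by apply: le_lt_trans (vmin p) _; apply/(dom_prox x b w gamma).
split => // y.
have := pf.1 y; case fyE : (f y) => [r||//] _; last by rewrite leey.
have fvE := proper_fin pf fv; set s := fine _ in fvE.
rewrite fvE -EFinD lee_fin innerNl.
set d := y - v; set G := inner _ _; set D := r - s + G.
(* Minimality against the point [v + t *: d] of the segment to [y], combined with convexity of [f]
   and divided by [t]. Letting [t] vanish would give [0 <= D]. *)
have hD (t : R) : 0 < t -> t <= 1 -> 0 <= D + t * prox_curv d.
  move=> t0 t1; have t01 : 0 <= t <= 1 by rewrite ltW.
  have := vmin (v + t *: d); rewrite /prox_objective prox_quadD.
  rewrite prox_curvZ innerZr -/G.
  have -> : v + t *: d = t *: y + (1 - t) *: v.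
    by rewrite /d scalerBr scalerBl scale1r addrC addrAC addrA.
  move=> h1; have := le_trans h1 (leeD2r _ (cf t y v t01)).
  rewrite fyE fvE -!EFinM -!EFinD lee_fin /D => h2.
  rewrite -(pmulr_rge0 _ t0); lra.
suff : 0 <= D by rewrite /D; lra.
rewrite leNgt; apply/negP => D0.
have C0 := prox_curv_ge0 d; set C := prox_curv d in hD C0 *.
have CD : 0 < C - D by lra.
(* An explicit small [t] in place of the limit: if [D < 0], this value lies in [(0, 1]] and makes
   the right-hand side [- D ^+ 2 / (C - D) < 0]. *)
have := hD (- D / (C - D)).
rewrite divr_gt0 ?oppr_gt0// ler_pdivrMr// => /(_ isT).
have -> : D + - D / (C - D) * C = - (D ^+ 2 / (C - D)) by field; rewrite gt_eqF.
have : 0 < D ^+ 2 / (C - D) by rewrite divr_gt0// exprn_even_gt0//= lt_eqF.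
by move=> ? h; have := h ltac:(lra); lra.
Qed.

(** A direction along which the sum never increases has zero curvature, so it is killed by [L] and
    [P]. The quadratic part is then constant along it, [f] itself recedes, and the hypothesis turns
    [u] into a direction of constancy, so that [- u] recedes as well. *)
Lemma argmin_prox_nonempty x b w gamma : recession_pos_mod_constancy f L P ->
  argmin (prox_objective x b w gamma) !=set0.
Proof.
move=> hrec; have [lf pf cf] := hf.
apply: argmin_nonempty; first exact: prox_objective_cpc.
move=> u hu; pose q := prox_quad x b w gamma.
have [p0 fp0] := pf.2.
have f0E := proper_fin pf fp0; set F0 := fine _ in f0E.
pose G := inner (prox_grad x b w p0) u.
have hray (rho : R) : 0 <= rho -> exists2 r : R, f (p0 + rho *: u) = r%:E &
    r + rho * G + rho ^+ 2 * prox_curv u <= F0.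
  move=> rho0; have := hu p0; rewrite dom_prox => /(_ fp0 rho rho0).
  rewrite /prox_objective prox_quadD prox_curvZ innerZr -/G f0E.
  have := pf.1 (p0 + rho *: u); case: (f _) => [r||//] _ //.
  by rewrite -!EFinD lee_fin => h; exists r => //; lra.
have [F1 f1E _] := hray 1 ler01.
(* Convexity through [p0], [p0 + u] and [p0 + rho *: u] bounds [f] below by an affine function of
   [rho], which cannot compensate for quadratic growth. *)
have curv_le (rho : R) : 1 <= rho -> rho * prox_curv u <= F0 - F1 - G.
  move=> rho1; have rho0 : 0 < rho by exact: lt_le_trans rho1.
  have [r rE hr] := hray rho (ltW rho0).
  have r01 : 0 <= rho^-1 <= 1 by rewrite invr_ge0 ltW//= invf_le1.
  have := cf _ (p0 + rho *: u) p0 r01.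
  have -> : rho^-1 *: (p0 + rho *: u) + (1 - rho^-1) *: p0 = p0 + 1 *: u.
    rewrite scalerDr scalerA mulVf ?gt_eqF// scalerBl !scale1r.
    by rewrite addrAC [_ + (p0 - _)]addrC subrK.
  rewrite rE f0E f1E -!EFinM -EFinD lee_fin => h1.
  rewrite -(ler_pM2l rho0).
  have : rho * F1 <= r + (rho - 1) * F0.
    have -> : r + (rho - 1) * F0 = rho * (rho^-1 * r + (1 - rho^-1) * F0).
      by field; rewrite gt_eqF.
    by rewrite ler_wpM2l// ltW.
  lra.
have c0 : prox_curv u = 0.
  apply/eqP; rewrite eq_le prox_curv_ge0 andbT leNgt; apply/negP => cp.
  set K := F0 - F1 - G in curv_le.
  have K0 : 0 <= `|K| / prox_curv u by rewrite divr_ge0// ltW.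
  have : K <= `|K| := ler_norm K.
  have := curv_le (1 + `|K| / prox_curv u); rewrite lerDl => /(_ K0).
  by rewrite mulrDl mulfVK ?gt_eqF// mul1r; lra.
have [Lu Pu] := prox_curv_eq0 c0.
have quad_cst p (rho : R) : q (p + rho *: u) = q p.
  rewrite /q prox_quadD prox_curvZ c0 mulr0 addr0 innerZr.
  rewrite /prox_grad innerDl hL Lu hP.1 Pu !inner0r; lra.
have rec0 : (recession f u <= 0)%E.
  apply: recession_le0_of_dom => // p fp rho rho0.
  have := hu p; rewrite dom_prox => /(_ fp rho rho0).
  by rewrite /prox_objective -/q quad_cst leeD2rE.
have [rn r0] : (recession f (- u)%R = - recession f u /\ - recession f u = 0)%E.
  by apply: contrapT => nc; have := hrec u Lu Pu nc; rewrite ltNge rec0.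
move=> p hp rho rho0; have fp : dom f p := (dom_prox x b w gamma p).1 hp.
rewrite /prox_objective -scalerN -/q.
have -> : q (p + rho *: - u) = q p by rewrite scalerN -scaleNr quad_cst.
by rewrite leeD2rE// recession_le0_dom// rn r0.
Qed.

(** Monotonicity between the two optimality conditions bounds the [Sig]-form of [d = v - v'] by
    minus the [sigma]-weighted [L]-term and the [P]-form. All three vanish, against definiteness of
    their sum. *)
Lemma argmin_prox_unique (Sig : {linear V -> V}) x b w gamma v v' :
  psd Sig -> subdiff_monotone_wrt f Sig ->
  posdef (fun u => Sig u + Ls (L u) + P u) ->
  argmin (prox_objective x b w gamma) v ->
  argmin (prox_objective x b w gamma) v' -> v = v'.
Proof.
move=> hSig mono [_ pd] /argmin_prox_subdiff[_ sv] /argmin_prox_subdiff[_ sv'].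
apply/eqP; rewrite -subr_eq0; apply/negPn/negP => /pd.
have := mono _ _ _ _ sv sv'; rewrite sqr_opnorm//.
set d := v - v'.
have -> : - prox_grad x b w v - - prox_grad x b w v' =
    - (prox_grad x b w v - prox_grad x b w v') by rewrite opprK opprB addrC.
have -> : prox_grad x b w v - prox_grad x b w v' = Ls (sigma *: L d) + P d.
  rewrite /prox_grad opprD addrACA -!linearB/= /d; congr (Ls _ + P _).
    by rewrite opprD addrACA subrr add0r -scalerBr opprD addrACA subrr addr0 (linearB L).
  by rewrite opprD addrACA subrr addr0.
rewrite innerNl (innerDl (Ls _)) hL innerZl hP.1 /= !innerDr (innerC d (Ls _)) hL.
have : 0 <= inner (L d) (L d) by exact: inner_ge0.
have := hP.2 d; have := hSig.2 d.
move: (inner d (Sig d)) (inner d (P d)) (inner (L d) (L d)) => a e l a0 e0 l0.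
have : 0 <= sigma * l by rewrite mulr_ge0// ltW.
move=> sl h1 h2.
have sl0 : sigma * l = 0 by lra.
have : l = 0 by move/eqP: sl0; rewrite mulf_eq0 gt_eqF//= => /eqP.
lra.
Qed.

End ProximalSubproblem.

(** * Limits of sequences *)

Section RealSequences.
Context {R : realType}.
Implicit Types (a d e : nat -> R).

(** Subtracting the partial sums of [e] from [a] gives a nonincreasing sequence bounded below; [d]
    is then squeezed by differences of consecutive terms of convergent sequences. *)
Lemma quasi_fejer a d e (K : R) :
  (forall k, 0 <= a k) -> (forall k, 0 <= d k) -> (forall k, 0 <= e k) ->
  (forall k, a k.+1 + d k <= a k + e k) ->
  (forall n, \sum_(0 <= i < n) e i <= K) ->
  cvgn a /\ d k @[k --> \oo] --> 0.
Proof.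
move=> a0 d0 e0 ade eK.
pose s n := \sum_(0 <= i < n) e i.
have sS n : s n.+1 = s n + e n by rewrite /s big_nat_recr.
have cs : cvgn s.
  apply: nondecreasing_is_cvgn; last by exists K => _ [n _ <-]; exact: eK.
  by apply/nondecreasing_seqP => n; rewrite sS lerDl.
have cb : cvgn (fun n => a n - s n).
  apply: nonincreasing_is_cvgn.
    apply/nonincreasing_seqP => n; rewrite sS.
    by have := ade n; have := d0 n; lra.
  exists (- K) => _ [n _ <-]; have := a0 n; have := eK n; rewrite -/(s n).
  by move=> ? ?; lra.
have ca : cvgn a.
  have -> : a = (fun n => (a n - s n) + s n) by apply/funext => n; rewrite subrK.
  exact: is_cvgD.
split => //.
apply: (@squeeze_cvgr _ _ _ _ (fun=> 0) (fun n => (a n - a n.+1) + (s n.+1 - s n))).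
- by near=> n; rewrite d0/= sS; have := ade n; lra.
- exact: cvg_cst.
- have -> : 0 = (limn a - limn a) + (limn s - limn s) :> R by rewrite !subrr addr0.
  have shift (u : nat -> R) : cvgn u -> u n.+1 @[n --> \oo] --> limn u.
    by move=> cu; rewrite (cvg_shiftS u).
  by apply: cvgD; apply: cvgB => //; exact: shift.
Unshelve. all: by end_near. Qed.

Lemma descent_sum_le a e (eps : R) : 0 < eps -> (forall k, 0 <= a k) ->
  (forall k, a k.+1 + eps * e k <= a k) ->
  forall n, \sum_(0 <= i < n) e i <= eps^-1 * a 0%N.
Proof.
move=> eps0 a0 ae n.
have h : a n + eps * \sum_(0 <= i < n) e i <= a 0%N.
  elim: n => [|n ih]; first by rewrite big_geq// mulr0 addr0.
  by rewrite big_nat_recr//= mulrDr; have := ae n; lra.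
rewrite -(ler_pM2l eps0) mulrA mulfV ?gt_eqF// mul1r.
by have := a0 n; lra.
Qed.

Lemma norm_le_cvg0 a e (M : R) : (forall k, `|a k| <= e k * M) ->
  e k @[k --> \oo] --> 0 -> a k @[k --> \oo] --> 0.
Proof.
move=> ae e0; apply/norm_cvg0P.
apply: (@squeeze_cvgr _ _ _ _ (fun=> 0) (fun n => e n * M)).
- by near=> n; rewrite normr_ge0 ae.
- exact: cvg_cst.
- by rewrite -[X in _ --> X](mul0r M); apply: cvgM => //; exact: cvg_cst.
Unshelve. all: by end_near. Qed.

Lemma sqr_cvg0 a : a k ^+ 2 @[k --> \oo] --> 0 -> a k @[k --> \oo] --> 0.
Proof.
move=> a20; apply/norm_cvg0P.
have -> : (fun k => `|a k|) = (fun k => Num.sqrt (a k ^+ 2)).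
  by apply/funext => k; rewrite sqrtr_sqr.
rewrite -[X in _ --> X]sqrtr0.
by apply: continuous_cvg => //; exact: sqrt_continuous.
Qed.

Lemma cvgn_norm_bounded a : cvgn a -> exists M : R, forall k, `|a k| <= M.
Proof.
move=> /cvg_seq_bounded[M [_ hM]]; exists (M + 1) => k.
by apply: hM => //; rewrite ltrDl.
Qed.

Lemma cvg_shift2 (u : nat -> R) (l : R) :
  u k.+2 @[k --> \oo] --> l -> u k @[k --> \oo] --> l.
Proof.
by move=> h; rewrite -(cvg_shiftS u) -(cvg_shiftS (fun k => u k.+1)).
Qed.

Lemma partial_sum_le_of_series a : (forall k, 0 <= a k) ->
  (\sum_(0 <= k <oo) (a k)%:E < +oo)%E ->
  exists K : R, forall n, \sum_(0 <= i < n) a i <= K.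
Proof.
move=> a0 afin; exists (fine (\sum_(0 <= k <oo) (a k)%:E)%E) => n.
have s0 : (0 <= \sum_(0 <= k <oo) (a k)%:E)%E.
  by apply: nneseries_ge0 => k _ _; rewrite lee_fin.
rewrite -lee_fin fineK; last by rewrite ge0_fin_numE.
by rewrite -sumEFin; apply: nneseries_lim_ge => k _ _; rewrite lee_fin.
Qed.

End RealSequences.

Section EuclideanSequences.
Context {R : realType} {V : euclideanType R}.
Implicit Types (u v : nat -> V).

Lemma sqr_norm_cvg0 u : `|u k| ^+ 2 @[k --> \oo] --> 0 -> u k @[k --> \oo] --> 0.
Proof. by move/sqr_cvg0/norm_cvg0P. Qed.

Lemma opnorm_cvg0 (P : {linear V -> V}) u : psd P ->
  opnorm P (u k) ^+ 2 @[k --> \oo] --> 0 -> P (u k) @[k --> \oo] --> 0.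
Proof.
move=> hP /sqr_cvg0 Pu; have [C C0 hC] := psd_bounded hP.
apply/norm_cvg0P; apply: (@norm_le_cvg0 _ _ (fun k => opnorm P (u k)) C) => // k.
by rewrite normr_id mulrC.
Qed.

Lemma cvg_of_subseq u (M : R) (p : V) : (forall k, `|u k| <= M) ->
  (forall (phi : nat -> nat) (q : V), (forall n, (n <= phi n)%N) -> u (phi n) @[n --> \oo] --> q -> q = p) ->
  u k @[k --> \oo] --> p.
Proof.
move=> uM hsub; apply: contrapT => nu.
have [e e0 ex] : exists2 e : R, 0 < e &
    forall N, exists n, (N <= n)%N /\ e <= `|p - u n|.
  apply: contrapT => ne; apply: nu; apply/cvgrPdist_lt => e e0.
  apply: contrapT => nn; apply: ne; exists e => // N; apply: contrapT => h.
  apply: nn; exists N => // n /= Nn; rewrite ltNge; apply/negP => en.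
  by apply: h; exists n.
have [chi hchi] := choice ex.
have [|phi [q hphi uq]] := @bounded_subseq _ _ (u \o chi) M.
  by move=> n; exact: uM.
have pq : q = p.
  apply: (hsub (chi \o phi)) => // n /=.
  by rewrite (leq_trans (hphi n))// (hchi _).1.
move: uq; rewrite pq => /cvgrPdist_lt/(_ e e0)[N _ /(_ N (leqnn N))]/=.
by rewrite ltNge (hchi _).2.
Qed.

End EuclideanSequences.

Lemma bounded_shift (R : realType) (V : normedModType R) (u : nat -> V) (M : R) :
  (forall k, `|u k.+1| <= M) -> exists N : R, forall k, `|u k| <= N.
Proof.
move=> uM; exists (Num.max `|u 0%N| M) => -[|k]; rewrite le_max ?lexx//.
by rewrite uM orbT.
Qed.

Lemma linear_map_bounded_shift (R : realType) (V W : euclideanType R) (L : {linear V -> W})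
    (u : nat -> V) (v : V) (M : R) : (forall k, `|L (u k - v)| <= M) ->
  forall k, `|L (u k)| <= M + `|L v|.
Proof.
move=> uM k; rewrite -[u k](subrK v) linearD (le_trans (ler_normD _ _))//.
by rewrite lerD2r.
Qed.

(** * Coercivity and duality *)

Section Coercivity.
Context {R : realType}.

(** Compactness of the unit sphere stands in for the smallest eigenvalue: if every constant [n.+1]
    failed, a limit of unit vectors would have a nonpositive form. *)
Lemma posdef_coercive (V : euclideanType R) (O : {linear V -> V}) : posdef O ->
  exists2 C : R, 0 <= C & forall u, `|u| ^+ 2 <= C * inner u (O u).
Proof.
move=> [_ pO].
have qO0 u : 0 <= inner u (O u).
  by have [->|/pO/ltW//] := eqVneq u 0; rewrite inner0l.
apply: contrapT => nC.
have ex n : exists u : V, `|u| = 1 /\ inner u (O u) <= n.+1%:R^-1.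
  have [u hu] : exists u, n.+1%:R * inner u (O u) < `|u| ^+ 2.
    apply: contrapT => h; apply: nC; exists n.+1%:R => // u.
    by rewrite leNgt; apply/negP => uu; apply: h; exists u.
  have u0 : 0 < `|u|.
    have : 0 < `|u| ^+ 2 by apply: le_lt_trans hu; rewrite mulr_ge0.
    by rewrite exprn_even_gt0//= normr_eq0 normr_gt0.
  exists (`|u|^-1 *: u); split.
    by rewrite normrZ normfV normr_id mulVf// gt_eqF.
  rewrite linearZ/= innerZl innerZr mulrA -invfM mulrC ler_pdivrMr ?mulr_gt0//.
  by rewrite mulrC ler_pdivlMr// mulrC -expr2 ltW.
have [u hu] := choice ex.
have [|phi [p hphi up]] := @bounded_subseq _ _ u 1; first by move=> n; rewrite (hu n).1.
have p1 : `|p| = 1.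
  have : `|u (phi n)| @[n --> \oo] --> `|p| by apply: cvg_norm; exact: up.
  under eq_fun do rewrite (hu _).1.
  by move/cvg_lim => <- //; exact: lim_cst.
have : inner p (O p) <= 0.
  have up2 : inner (u (phi n)) (O (u (phi n))) @[n --> \oo] --> inner p (O p).
    apply: inner_cvg => //; apply: continuous_cvg => //.
    exact: linear_map_continuous.
  have n0 : n.+1%:R^-1 @[n --> \oo] --> (0 : R) := cvg_harmonic.
  apply: (ler_cvg_to up2 n0); near=> n.
  rewrite (le_trans (hu _).2)// lef_pV2 ?posrE//.
  by rewrite ler_nat ltnS.
rewrite leNgt pO//; apply: contra_eq_neq p1 => ->.
by rewrite normr0 eq_sym oner_neq0.
Unshelve. all: by end_near. Qed.

(** An unbounded sequence has a limiting unit direction. Bounded images under [L] and [P] put it in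
    both kernels, and bounded values of [f] make it a recession direction, which [recession_pos]
    excludes. *)
Lemma bounded_of_recession_pos (X V : euclideanType R) (f : V -> \bar R)
    (L : {linear V -> X}) (P : {linear V -> V}) (u : nat -> V) (M : R) :
  closed_proper_convex f -> recession_pos f L P ->
  (forall n, (f (u n) <= M%:E)%E) ->
  (forall n, `|L (u n)| <= M) -> (forall n, `|P (u n)| <= M) ->
  exists N : R, forall n, `|u n| <= N.
Proof.
move=> hf hrec fM LM PM; apply: contrapT => nb.
have [psi [d d1 [t0 tu]]] := unbounded_direction nb.
have dn0 : d != 0.
  by apply: contra_eq_neq d1 => ->; rewrite normr0 eq_sym oner_neq0.
have ker (W : euclideanType R) (K : {linear V -> W}) :
    (forall n, `|K (u n)| <= M) -> K d = 0.
  move=> KM.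
  have c1 : K (`|u (psi n)|^-1 *: u (psi n)) @[n --> \oo] --> K d.
    by apply: continuous_cvg => //; exact: linear_map_continuous.
  have c0 : K (`|u (psi n)|^-1 *: u (psi n)) @[n --> \oo] --> (0 : W).
    apply/norm_cvg0P; apply: (@norm_le_cvg0 _ _ (fun n => `|u (psi n)|^-1) M) => // n.
    by rewrite normr_id linearZ/= normrZ normfV normr_id ler_wpM2l ?invr_ge0.
  by rewrite -(cvg_lim _ c1)// (cvg_lim _ c0).
have := hrec d dn0 (ker _ L LM) (ker _ P PM).
rewrite ltNge recession_le0_of_dom//.
apply: (recession_direction (y := u \o psi) (M := M) hf _ t0 tu) => n /=.
  by rewrite invr_ge0.
exact: fM.
Qed.

End Coercivity.

(** * Subgradients and conjugates *)

Section Subdifferential.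
Context {R : realType} {V : euclideanType R}.
Implicit Types (f : V -> \bar R).

Lemma subdiff_dom f v w : Defs.proper f -> subdiff f v w -> dom f v.
Proof.
move=> [fN [p fp]] /(_ p); rewrite /dom/= in fp *.
by have := fN v; case: (f v) => [s|//|//] _; rewrite ?ltry// addye// leye_eq => /eqP pE; rewrite pE in fp.
Qed.

Lemma subdiff_fine f v w u : Defs.proper f -> subdiff f v w -> dom f u ->
  fine (f v) + inner w (u - v) <= fine (f u).
Proof.
move=> pf sv fu; have := sv u.
by rewrite (proper_fin pf (subdiff_dom pf sv)) (proper_fin pf fu) -EFinD lee_fin.
Qed.

Lemma subdiffP f v w : Defs.proper f -> dom f v ->
  (forall u, dom f u -> fine (f v) + inner w (u - v) <= fine (f u)) ->
  subdiff f v w.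
Proof.
move=> pf fv h u; have [fu|nfu] := pselect (dom f u).
  by rewrite (proper_fin pf fv) (proper_fin pf fu) -EFinD lee_fin h.
suff -> : f u = +oo%E by rewrite leey.
by move: nfu; rewrite /dom/= ltey; move/negP/negPn/eqP.
Qed.

(** The equality case of the Fenchel-Young inequality. *)
Lemma conjugate_subdiff f v w : Defs.proper f -> subdiff f v w ->
  conjugate f w = (inner w v - fine (f v))%:E.
Proof.
move=> pf sv; have fv := subdiff_dom pf sv; have fvE := proper_fin pf fv.
apply/eqP; rewrite eq_le; apply/andP; split; last first.
  by apply: ereal_sup_ubound; exists v => //; rewrite {1}fvE EFinB.
apply: ge_ereal_sup => _ [u _ <-].
have := sv u; rewrite fvE; have := pf.1 u.
case: (f u) => [s||//] _; last by rewrite addeNy leNye.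
by rewrite -EFinD -EFinB !lee_fin innerBr; lra.
Qed.

Lemma conjugate_ge f v w : Defs.proper f -> dom f v ->
  ((inner w v - fine (f v))%:E <= conjugate f w)%E.
Proof.
move=> pf fv; apply: ereal_sup_ubound; exists v => //.
by rewrite (proper_fin pf fv) EFinB.
Qed.

End Subdifferential.

Section Duality.
Context {R : realType} {X Y Z : euclideanType R}.
Variables (f : Y -> \bar R) (g : Z -> \bar R).
Variables (A : X -> Y) (As : Y -> X) (B : X -> Z) (Bs : Z -> X) (c : X).
Hypotheses (pf : Defs.proper f) (pg : Defs.proper g).
Hypotheses (hA : adjoint A As) (hB : adjoint B Bs).
Variables (x : X) (y : Y) (z : Z).
Hypothesis kk : kkt f g A As B Bs c (x, y, z).

Local Notation pstar := (fine (f y) + fine (g z)).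

(** Fenchel-Young at the primal pair [(y, z)] bounds every dual value by [pstar]; at [x] both
    inequalities are equalities. *)
Lemma kkt_dual_solution : dual_solution f g A B c x.
Proof.
have [fs gs con] := kk.
have fy := subdiff_dom pf fs; have gz := subdiff_dom pg gs.
move=> x'.
have -> : dual_objective f g A B c x = pstar%:E.
  rewrite /dual_objective (conjugate_subdiff pf fs) (conjugate_subdiff pg gs).
  rewrite -!EFinN -!EFinD -con !innerNl hA hB innerDl.
  by rewrite (innerC (As y)) (innerC (Bs z)); congr _%:E; lra.
have := conjugate_ge (- A x') pf fy; have := conjugate_ge (- B x') pg gz.
rewrite /dual_objective; case: (conjugate f _) => [s||] //; last first.
  by rewrite /= addNye leNye.
case: (conjugate g _) => [t||] //; last by rewrite /= addeNy leNye.
rewrite -!EFinN -!EFinD !lee_fin -con !innerNl hA hB innerDl.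
rewrite (innerC (As y)) (innerC (Bs z)); lra.
Qed.

Lemma kkt_primal_value : primal_value f g As Bs c = pstar%:E.
Proof.
have [fs gs con] := kk.
have fy := subdiff_dom pf fs; have gz := subdiff_dom pg gs.
apply/eqP; rewrite eq_le; apply/andP; split.
  apply: ereal_inf_lbound; exists (y, z) => //=.
  by rewrite EFinD -(proper_fin pf fy) -(proper_fin pg gz).
apply: le_ereal_inf_tmp => _ [[y' z'] /= con' <-].
have := fs y'; have := gs z'.
rewrite (proper_fin pf fy) (proper_fin pg gz).
have := pg.1 z'; have := pf.1 y'.
case: (f y') => [s||//] _; last by case: (g z') => [t||//] _ _ _; rewrite leey.
case: (g z') => [t||//] _; last by move=> _ _; rewrite leey.
rewrite -!EFinD !lee_fin !innerNl hA hB.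
(* Both pairs are feasible, so the multiplier terms of the two subgradient inequalities cancel in
   the sum. *)
have : inner x (As (y' - y)) + inner x (Bs (z' - z)) = 0.
  have hA' : inner x (As (y' - y)) = inner x (As y') - inner x (As y).
    by rewrite -!hA innerBr.
  have hB' : inner x (Bs (z' - z)) = inner x (Bs z') - inner x (Bs z).
    by rewrite -!hB innerBr.
  rewrite hA' hB'; have : inner x c = inner x (As y) + inner x (Bs z).
    by rewrite -con innerDr.
  by rewrite -con' innerDr; lra.
lra.
Qed.

End Duality.

(** * Convergence analysis *)

Section ThreePoint.
Context {R : realType} {V : euclideanType R}.

Lemma psd_three_point (P : {linear V -> V}) (a b : V) : psd P ->
  2 * inner (P (a - b)) a =
  opnorm P a ^+ 2 - opnorm P b ^+ 2 + opnorm P (a - b) ^+ 2.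
Proof.
move=> hP; rewrite !sqr_opnorm// hP.1 !linearB/= !(innerDl, innerDr, innerNl, innerNr).
have -> : inner b (P a) = inner a (P b) by rewrite -hP.1 innerC.
lra.
Qed.

Lemma psd_young (P : {linear V -> V}) (a b : V) : psd P ->
  2 * inner (P b) a <= opnorm P a ^+ 2 + opnorm P b ^+ 2.
Proof.
move=> hP; have := psd_three_point a b hP.
have := sqr_ge0 (opnorm P (a - b)); rewrite linearB/= innerBl.
rewrite sqr_opnorm// [inner (P a) a]innerC; lra.
Qed.

Lemma young (a b : V) (t : R) : 0 < t ->
  2 * inner a b <= t * `|a| ^+ 2 + t^-1 * `|b| ^+ 2.
Proof.
move=> t0; have := inner_ge0 (t *: a - b).
rewrite !sqr_normE !innerE (innerC b a) => h.
rewrite -(ler_pM2l t0) mulrDr (mulrA t t^-1) mulfV ?gt_eqF// mul1r; lra.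
Qed.

End ThreePoint.

(** * Lyapunov analysis of the iterates *)

Section Iteration.
Context {R : realType} {X Y Z : euclideanType R}.
Variables (f : Y -> \bar R) (g : Z -> \bar R).
Variables (A : {linear X -> Y}) (As : {linear Y -> X}).
Variables (B : {linear X -> Z}) (Bs : {linear Z -> X}) (c : X).
Variables (sigma tau : R).
Variables (S Sigmaf : {linear Y -> Y}) (T Sigmag : {linear Z -> Z}).
Hypotheses (hf : closed_proper_convex f) (hg : closed_proper_convex g).
Hypotheses (hA : adjoint A As) (hB : adjoint B Bs).
Hypotheses (sigma0 : 0 < sigma) (tau0 : 0 < tau).
Hypotheses (hS : psd S) (hT : psd T).
Hypotheses (hSigmaf : psd Sigmaf) (hSigmag : psd Sigmag).
Hypotheses (fmono : subdiff_monotone_wrt f Sigmaf).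
Hypotheses (gmono : subdiff_monotone_wrt g Sigmag).
Variables (x : nat -> X) (y : nat -> Y) (z : nat -> Z).

Definition residual k : X := As (y k) + Bs (z k) - c.

(** The subgradient at [y k.+1] given by the optimality condition of the [y]-step. That step still
    sees [z k], hence the correction of the residual by [Bs (z k - z k.+1)]. *)
Definition f_subgrad k : Y :=
  - (A (x k + sigma *: (residual k.+1 + Bs (z k - z k.+1))) + S (y k.+1 - y k)).

Definition g_subgrad k : Z :=
  - (B (x k + sigma *: residual k.+1) + T (z k.+1 - z k)).

Hypotheses (fy : forall k, dom f (y k)) (gz : forall k, dom g (z k)).
Hypothesis f_opt : forall k, subdiff f (y k.+1) (f_subgrad k).
Hypothesis g_opt : forall k, subdiff g (z k.+1) (g_subgrad k).
Hypothesis x_step : forall k, x k.+1 = x k + (tau * sigma) *: residual k.+1.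

(** By the subgradient inequalities this bounds from above the excess of the objective at iterate
    [k.+1] over its value at [(yb, zb)]. *)
Definition gap (yb : Y) (zb : Z) k : R :=
  inner (f_subgrad k) (y k.+1 - yb) + inner (g_subgrad k) (z k.+1 - zb).

Lemma residualE yb zb k : As yb + Bs zb = c ->
  As (y k - yb) = residual k - Bs (z k - zb).
Proof.
by move=> con; rewrite /residual -con (linearB As) (linearB Bs) opprD addrACA addrK.
Qed.

Lemma gapE yb zb k : As yb + Bs zb = c ->
  gap yb zb k =
  - inner (x k + sigma *: residual k.+1) (residual k.+1)
  - sigma * inner (Bs (z k - z k.+1)) (As (y k.+1 - yb))
  - inner (S (y k.+1 - y k)) (y k.+1 - yb)
  - inner (T (z k.+1 - z k)) (z k.+1 - zb).
Proof.
move=> con; rewrite /gap /f_subgrad /g_subgrad.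
rewrite !innerNl !(innerDl (A _)) !(innerDl (B _)) hA hB.
rewrite (residualE k.+1 con); set r := residual _; set q := Bs (z k.+1 - zb).
set e := Bs _; rewrite !innerE; lra.
Qed.

Definition lyapunov (xb : X) (yb : Y) (zb : Z) k : R :=
  (tau * sigma)^-1 * `|x k - xb| ^+ 2 + sigma * `|Bs (z k - zb)| ^+ 2 +
  opnorm S (y k - yb) ^+ 2 + opnorm T (z k - zb) ^+ 2.

(** An algebraic identity: three-point formulas turn the pairings into differences of squares. In
    [2 - tau], the 2 comes from the penalty term of the subgradients and [tau] from expanding the
    multiplier update. *)
Lemma lyapunov_step xb yb zb k : As yb + Bs zb = c ->
  2 * (gap yb zb k + inner xb (residual k.+1)) =
  lyapunov xb yb zb k - lyapunov xb yb zb k.+1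
  - (2 - tau) * sigma * `|residual k.+1| ^+ 2
  + 2 * sigma * inner (residual k.+1) (Bs (z k.+1 - z k))
  - sigma * `|Bs (z k.+1 - z k)| ^+ 2
  - opnorm S (y k.+1 - y k) ^+ 2 - opnorm T (z k.+1 - z k) ^+ 2.
Proof.
move=> con; rewrite gapE// /lyapunov.
have yE : y k.+1 - y k = (y k.+1 - yb) - (y k - yb) by rewrite opprB addrA subrK.
have zE : z k.+1 - z k = (z k.+1 - zb) - (z k - zb) by rewrite opprB addrA subrK.
have zE' : Bs (z k - z k.+1) = Bs (z k - zb) - Bs (z k.+1 - zb).
  by rewrite -linearB opprB addrA subrK.
have BE : Bs (z k.+1 - z k) = Bs (z k.+1 - zb) - Bs (z k - zb).
  by rewrite -linearB opprB addrA subrK.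
have Sp := psd_three_point (y k.+1 - yb) (y k - yb) hS.
have Tp := psd_three_point (z k.+1 - zb) (z k - zb) hT.
rewrite -yE in Sp; rewrite -zE in Tp.
rewrite BE zE' (residualE k.+1 con).
have xE : x k.+1 - xb = (x k - xb) + (tau * sigma) *: residual k.+1.
  by rewrite x_step addrAC.
have -> : (tau * sigma)^-1 * `|x k.+1 - xb| ^+ 2 =
    (tau * sigma)^-1 * `|x k - xb| ^+ 2 +
    2 * inner (x k - xb) (residual k.+1) +
    tau * sigma * `|residual k.+1| ^+ 2.
  rewrite xE !sqr_normE; move: (x k - xb) (residual k.+1) => xi r.
  rewrite !innerE (innerC r xi); field.
  by rewrite !gt_eqF.
move: Sp Tp (Bs (z k - zb)) (Bs (z k.+1 - zb)) (residual k.+1) => Sp Tp b b' r.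
rewrite !sqr_normE !innerE (innerC b' b) (innerC b' r) (innerC b r); lra.
Qed.

(** Monotonicity of the subdifferential of [g] at two consecutive iterates: since [x] moves by
    [tau * sigma] times the old residual, the multipliers inside the subgradients differ by [sigma]
    times the new residual minus [(1 - tau) * sigma] times the old one. Young's inequality treats
    the [T]-terms. *)
Lemma residual_cross k :
  2 * sigma * inner (residual k.+2) (Bs (z k.+2 - z k.+1)) <=
  2 * (1 - tau) * sigma * inner (residual k.+1) (Bs (z k.+2 - z k.+1))
  - opnorm T (z k.+2 - z k.+1) ^+ 2 + opnorm T (z k.+1 - z k) ^+ 2.
Proof.
have := gmono (g_opt k.+1) (g_opt k); rewrite /g_subgrad.
have := sqr_ge0 (opnorm Sigmag (z k.+2 - z k.+1)).
move: (opnorm Sigmag _ ^+ 2) => m m0.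
rewrite x_step; move: (residual k.+1) (residual k.+2) => r r'.
rewrite innerBl !innerNl !innerDl !hB.
have := psd_young (z k.+2 - z k.+1) (z k.+1 - z k) hT.
have := sqr_opnorm (z k.+2 - z k.+1) hT; rewrite -hT.1.
move: (Bs (z k.+2 - z k.+1)) => e.
move: (opnorm T (z k.+2 - z k.+1)) (opnorm T (z k.+1 - z k)) => p q.
rewrite !innerDl !innerZl; lra.
Qed.

(** The added [T]-term is the one left over by [residual_cross]; included here, it telescopes. *)
Definition energy xb yb zb k : R :=
  lyapunov xb yb zb k.+1 + opnorm T (z k.+1 - z k) ^+ 2.

Lemma lyapunov_ge0 xb yb zb k : 0 <= lyapunov xb yb zb k.
Proof.
rewrite /lyapunov !addr_ge0 ?sqr_ge0//; rewrite mulr_ge0 ?exprn_ge0 ?(ltW sigma0)//.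
by rewrite invr_ge0 mulr_ge0// ltW.
Qed.

Lemma energy_ge0 xb yb zb k : 0 <= energy xb yb zb k.
Proof. by rewrite addr_ge0 ?sqr_ge0// lyapunov_ge0. Qed.

Lemma gap_ge xb yb zb k : kkt f g A As B Bs c (xb, yb, zb) ->
  opnorm Sigmaf (y k.+1 - yb) ^+ 2 + opnorm Sigmag (z k.+1 - zb) ^+ 2 <=
  gap yb zb k + inner xb (residual k.+1).
Proof.
move=> [fb gb con].
have := fmono (f_opt k) fb; have := gmono (g_opt k) gb.
rewrite !opprK (innerDl (f_subgrad _)) (innerDl (g_subgrad _)).
rewrite (hA xb) (hB xb).
rewrite (residualE k.+1 con) /gap (innerBr xb); lra.
Qed.

Lemma energy_step xb yb zb k : kkt f g A As B Bs c (xb, yb, zb) ->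
  energy xb yb zb k.+1
  + (opnorm S (y k.+2 - y k.+1) ^+ 2 + opnorm T (z k.+2 - z k.+1) ^+ 2
     + 2 * opnorm Sigmaf (y k.+2 - yb) ^+ 2 + 2 * opnorm Sigmag (z k.+2 - zb) ^+ 2)
  + sigma * `|Bs (z k.+2 - z k.+1)| ^+ 2
  + (2 - tau) * sigma * `|residual k.+2| ^+ 2 <=
  energy xb yb zb k
  + 2 * (1 - tau) * sigma * inner (residual k.+1) (Bs (z k.+2 - z k.+1)).
Proof.
move=> kk; have := gap_ge k.+1 kk; have [_ _ con] := kk.
have := lyapunov_step xb k.+1 con; have := residual_cross k.
rewrite /energy; lra.
Qed.

Lemma residual_summable_small_tau xb yb zb : kkt f g A As B Bs c (xb, yb, zb) ->
  tau < (1 + Num.sqrt 5) / 2 ->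
  exists K : R, forall n, \sum_(0 <= i < n) `|residual i.+1| ^+ 2 <= K.
Proof.
move=> kk tau_lt.
have golden : 0 < 1 + tau - tau ^+ 2.
  have s5 : Num.sqrt 5 ^+ 2 = 5 :> R by rewrite sqr_sqrtr.
  have s1 : 1 < Num.sqrt 5 :> R by rewrite -[ltLHS]sqrtr1 ltr_sqrt ?ltr1n.
  move: (Num.sqrt 5) s5 s1 tau_lt => s s5 s1 ts.
  (* With [s ^+ 2 = 5], this product is four times [1 + tau - tau ^+ 2]. *)
  have : 0 < (s - (2 * tau - 1)) * (s + (2 * tau - 1)) by have := tau0 => t0; apply: mulr_gt0; lra.
  nra.
suff [m [eps [m0 eps0 hm]]] : exists m eps : R, [/\ 0 <= m, 0 < eps &
    forall k, (energy xb yb zb k.+1 + m * `|residual k.+2| ^+ 2)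
              + eps * `|residual k.+2| ^+ 2 <=
              energy xb yb zb k + m * `|residual k.+1| ^+ 2].
  pose a k := energy xb yb zb k + m * `|residual k.+1| ^+ 2.
  have a0 k : 0 <= a k by rewrite addr_ge0 ?energy_ge0 ?mulr_ge0.
  have h := @descent_sum_le _ a (fun k => `|residual k.+2| ^+ 2) eps eps0 a0 hm.
  exists (`|residual 1| ^+ 2 + eps^-1 * a 0%N) => -[|n].
    by rewrite big_geq// addr_ge0 ?sqr_ge0// mulr_ge0// invr_ge0 ltW.
  by rewrite big_nat_recl//= lerD2l.
(* For [tau <= 1], Young with weight 1 costs [(1 - tau) * sigma] on both squares; as
   [2 - tau = (1 - tau) + 1], a surplus [sigma] remains on the new residual. *)
have [t1|t1] := leP tau 1.
  exists ((1 - tau) * sigma), sigma; split=> //; first by rewrite mulr_ge0 ?subr_ge0// ltW.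
  move=> k; have := energy_step k kk.
  have := young (residual k.+1) (Bs (z k.+2 - z k.+1)) ltr01.
  have := sqr_ge0 (opnorm S (y k.+2 - y k.+1)).
  have := sqr_ge0 (opnorm T (z k.+2 - z k.+1)).
  have := sqr_ge0 (opnorm Sigmaf (y k.+2 - yb)).
  have := sqr_ge0 (opnorm Sigmag (z k.+2 - zb)).
  have := sqr_ge0 `|Bs (z k.+2 - z k.+1)|.
  rewrite invr1 !mul1r; set b := `|Bs _| ^+ 2; set i := inner _ _.
  set r := `|residual k.+1| ^+ 2; set r' := `|residual k.+2| ^+ 2.
  move=> b0 p1 p2 p3 p4 yg.
  have st : 0 <= (1 - tau) * sigma by rewrite mulr_ge0 ?subr_ge0// ltW.
  have := ler_wpM2l st yg.
  have : 0 <= tau * sigma * b by rewrite !mulr_ge0// ltW.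
  lra.
(* Young with weight [tau^-1] leaves [(1 + tau - tau ^+ 2) * sigma] on the [Bs]-term, and the same
   quantity divided by [tau] on the new residual, so one condition makes both nonnegative. *)
exists ((tau - 1) / tau * sigma), ((1 + tau - tau ^+ 2) / tau * sigma); split.
- by rewrite mulr_ge0 ?(ltW sigma0)// divr_ge0 ?(ltW tau0)// subr_ge0 ltW.
- by rewrite mulr_gt0// divr_gt0.
move=> k; have := energy_step k kk.
have := young (- residual k.+1) (Bs (z k.+2 - z k.+1)) (t := tau^-1).
rewrite invr_gt0 => /(_ tau0).
have := sqr_ge0 (opnorm S (y k.+2 - y k.+1)).
have := sqr_ge0 (opnorm T (z k.+2 - z k.+1)).
have := sqr_ge0 (opnorm Sigmaf (y k.+2 - yb)).
have := sqr_ge0 (opnorm Sigmag (z k.+2 - zb)).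
have := sqr_ge0 `|Bs (z k.+2 - z k.+1)|.
rewrite invrK normrN innerNl; set b := `|Bs _| ^+ 2; set i := inner _ _.
set r := `|residual k.+1| ^+ 2; set r' := `|residual k.+2| ^+ 2.
move=> b0 p1 p2 p3 p4 yg.
have st : 0 <= (tau - 1) * sigma by rewrite mulr_ge0 ?(ltW sigma0)// subr_ge0 ltW.
have h1 := ler_wpM2l st yg.
have h2 : 0 <= (1 + tau - tau ^+ 2) * sigma * b by rewrite !mulr_ge0// ltW.
have -> : energy xb yb zb k.+1 + (tau - 1) / tau * sigma * r'
  + (1 + tau - tau ^+ 2) / tau * sigma * r' =
  energy xb yb zb k.+1 + (2 - tau) * sigma * r' by field; rewrite gt_eqF.
have -> : (tau - 1) / tau * sigma * r = (tau - 1) * sigma * (tau^-1 * r) by lra.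
lra.
Qed.

Lemma residual_summable_of_steps :
  (\sum_(0 <= k <oo) (`|x k.+1 - x k| ^+ 2)%:E < +oo)%E ->
  exists K : R, forall n, \sum_(0 <= i < n) `|residual i.+1| ^+ 2 <= K.
Proof.
move=> /partial_sum_le_of_series[k|K hK]; first exact: sqr_ge0.
have ts0 : 0 < tau * sigma by exact: mulr_gt0.
exists ((tau * sigma) ^- 2 * K) => n.
rewrite ler_pdivlMl ?exprn_gt0// mulr_sumr; apply: le_trans (hK n).
rewrite le_eqVlt; apply/predU1P; left; apply: eq_bigr => i _.
by rewrite x_step addrAC subrr add0r normrZ gtr0_norm// !exprMn.
Qed.

(** * Consequences of square-summable residuals *)

Hypothesis residual_sum :
  exists K : R, forall n, \sum_(0 <= i < n) `|residual i.+1| ^+ 2 <= K.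

Lemma residual_cvg0 : residual k.+1 @[k --> \oo] --> 0.
Proof.
have [K hK] := residual_sum.
pose q k := `|residual k.+1| ^+ 2; have q0 k : 0 <= q k by exact: sqr_ge0.
(* Summable terms vanish: the quasi-Fejer lemma with [a = 0] and [d = e]. *)
have [_ h] := @quasi_fejer R (fun=> 0) q q K (fun=> lexx 0) q0 q0 (fun=> lexx _) hK.
exact: sqr_norm_cvg0 h.
Qed.

Definition decrease yb zb k : R :=
  (opnorm S (y k.+2 - y k.+1) ^+ 2 + opnorm T (z k.+2 - z k.+1) ^+ 2
     + 2 * opnorm Sigmaf (y k.+2 - yb) ^+ 2 + 2 * opnorm Sigmag (z k.+2 - zb) ^+ 2)
  + sigma / 2 * `|Bs (z k.+2 - z k.+1)| ^+ 2.

Lemma energy_fejer xb yb zb : kkt f g A As B Bs c (xb, yb, zb) ->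
  cvgn (energy xb yb zb) /\ decrease yb zb k @[k --> \oo] --> 0.
Proof.
move=> kk; have [K hK] := residual_sum.
(* Young with weight 2 on the cross term spends half of the [Bs]-term, whence [sigma / 2] in
   [decrease]. The second summand dominates the residual term of [energy_step], which has the wrong
   sign for [tau > 2]. *)
pose e k := sigma * (2 * (1 - tau) ^+ 2) * `|residual k.+1| ^+ 2
            + sigma * tau * `|residual k.+2| ^+ 2.
have s1 : 0 <= sigma * (2 * (1 - tau) ^+ 2)
  by apply: mulr_ge0; [exact: ltW|apply: mulr_ge0 => //; exact: sqr_ge0].
have s2 : 0 <= sigma * tau by rewrite mulr_ge0// ltW.
apply: (@quasi_fejer R (energy xb yb zb) (decrease yb zb) e (sigma * (2 * (1 - tau) ^+ 2) * K + sigma * tau * K)).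
- by move=> k; exact: energy_ge0.
- move=> k; rewrite /decrease !addr_ge0 ?sqr_ge0//; rewrite mulr_ge0 ?sqr_ge0//.
  by rewrite divr_ge0// ltW.
- by move=> k; apply: addr_ge0; apply: mulr_ge0 => //; exact: sqr_ge0.
- move=> k; have := energy_step k kk; rewrite /decrease /e.
  have := young ((1 - tau) *: residual k.+1) (Bs (z k.+2 - z k.+1)) (t := 2).
  rewrite ltr0n => /(_ isT); rewrite innerZl normrZ exprMn real_normK ?num_real//.
  move=> yg; have := ler_wpM2l (ltW sigma0) yg.
  have : 0 <= sigma * `|residual k.+2| ^+ 2 by rewrite mulr_ge0 ?sqr_ge0// ltW.
  lra.
- move=> n; rewrite /e big_split/= -!mulr_sumr lerD// ler_wpM2l//.
  apply: le_trans (hK n.+1); rewrite [leRHS]big_nat_recl//= lerDr.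
  exact: sqr_ge0.
Qed.

Lemma vanishing_terms xb yb zb : kkt f g A As B Bs c (xb, yb, zb) ->
  [/\ opnorm S (y k.+1 - y k) ^+ 2 @[k --> \oo] --> 0,
      opnorm T (z k.+1 - z k) ^+ 2 @[k --> \oo] --> 0,
      opnorm Sigmaf (y k - yb) ^+ 2 @[k --> \oo] --> 0,
      opnorm Sigmag (z k - zb) ^+ 2 @[k --> \oo] --> 0 &
      `|Bs (z k.+1 - z k)| ^+ 2 @[k --> \oo] --> 0].
Proof.
move=> /energy_fejer[_ d0].
have shift1 (q : nat -> R) : q k.+1 @[k --> \oo] --> 0 -> q k @[k --> \oo] --> 0.
  by rewrite (cvg_shiftS q).
have dom (q : nat -> R) (C : R) : (forall k, 0 <= q k <= decrease yb zb k * C) ->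
    q k @[k --> \oo] --> 0.
  move=> hq; apply: (norm_le_cvg0 (M := C) _ d0) => k; have /andP[q0 q1] := hq k.
  by rewrite ger0_norm.
have pos k := (sqr_ge0 (opnorm S (y k.+2 - y k.+1)),
  sqr_ge0 (opnorm T (z k.+2 - z k.+1)), sqr_ge0 (opnorm Sigmaf (y k.+2 - yb)),
  sqr_ge0 (opnorm Sigmag (z k.+2 - zb)),
  mulr_ge0 (ltW sigma0) (sqr_ge0 `|Bs (z k.+2 - z k.+1)|)).
split.
- apply: shift1; apply: (dom _ 1) => k; rewrite sqr_ge0/= /decrease.
  by have [[[[]]]] := pos k; lra.
- apply: shift1; apply: (dom _ 1) => k; rewrite sqr_ge0/= /decrease.
  by have [[[[]]]] := pos k; lra.
- apply: cvg_shift2; apply: (dom _ 1) => k; rewrite sqr_ge0/= /decrease.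
  by have [[[[]]]] := pos k; lra.
- apply: cvg_shift2; apply: (dom _ 1) => k; rewrite sqr_ge0/= /decrease.
  by have [[[[]]]] := pos k; lra.
- apply: shift1; apply: (dom _ (2 / sigma)) => k; rewrite sqr_ge0/= /decrease.
  rewrite mulrA ler_pdivlMr//; have [[[[]]]] := pos k; lra.
Qed.

Lemma lyapunov_cvg xb yb zb : kkt f g A As B Bs c (xb, yb, zb) ->
  cvgn (lyapunov xb yb zb).
Proof.
move=> kk; have [ce _] := energy_fejer kk; have [_ t0 _ _ _] := vanishing_terms kk.
apply/cvg_ex; exists (limn (energy xb yb zb) - 0).
rewrite -(cvg_shiftS (lyapunov xb yb zb)).
have -> : (fun k => lyapunov xb yb zb k.+1) =
    (fun k => energy xb yb zb k - opnorm T (z k.+1 - z k) ^+ 2).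
  by apply/funext => k; rewrite /energy addrK.
exact: cvgB.
Qed.

(** Convergence of the Lyapunov function bounds each of its terms; [As] is then bounded through the
    residual, which is controlled from index 1 on. *)
Lemma iterates_bounded xb yb zb : kkt f g A As B Bs c (xb, yb, zb) ->
  exists M : R, forall k, [/\ `|x k| <= M, opnorm S (y k - yb) <= M,
    opnorm T (z k - zb) <= M, `|Bs (z k - zb)| <= M & `|As (y k.+1 - yb)| <= M].
Proof.
move=> kk; have [L hL] := cvgn_norm_bounded (lyapunov_cvg kk).
have [_ _ con] := kk.
have [N hN] : exists N : R, forall k, `| `|residual k.+1| | <= N.
  apply: cvgn_norm_bounded; apply/cvg_ex; exists `|0 : X|.
  by apply: cvg_norm; exact: residual_cvg0.
have ts0 : 0 < tau * sigma by exact: mulr_gt0.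
have sq1 (t : R) : t <= 1 + t ^+ 2 by nra.
have hk k : [/\ `|x k - xb| ^+ 2 <= tau * sigma * L, opnorm S (y k - yb) ^+ 2 <= L,
    opnorm T (z k - zb) ^+ 2 <= L & `|Bs (z k - zb)| ^+ 2 <= sigma^-1 * L].
  have := le_trans (ler_norm _) (hL k); rewrite /lyapunov.
  have : 0 <= (tau * sigma)^-1 * `|x k - xb| ^+ 2.
    by rewrite mulr_ge0 ?sqr_ge0// invr_ge0 ltW.
  have : 0 <= sigma * `|Bs (z k - zb)| ^+ 2 by rewrite mulr_ge0 ?sqr_ge0// ltW.
  have := sqr_ge0 (opnorm S (y k - yb)); have := sqr_ge0 (opnorm T (z k - zb)).
  move=> a1 a2 a3 a4 a5; split; [|lra|lra|].
  - by rewrite -ler_pdivrMl//; lra.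
  - by rewrite ler_pdivlMl//; lra.
have L0 : 0 <= L by exact: le_trans (normr_ge0 _) (hL 0%N).
have N0 : 0 <= N by exact: le_trans (normr_ge0 _) (hN 0%N).
have b1 : 0 <= tau * sigma * L by rewrite mulr_ge0// ltW.
have b2 : 0 <= sigma^-1 * L by rewrite mulr_ge0// invr_ge0 ltW.
exists (1 + tau * sigma * L + `|xb| + L + (1 + sigma^-1 * L) + N) => k.
have [h1 h2 h3 h4] := hk k; have [_ _ _ h5] := hk k.+1.
have xb0 := normr_ge0 xb.
have Bk := le_trans (sq1 _) (lerD (lexx 1) h4).
have Bk1 := le_trans (sq1 _) (lerD (lexx 1) h5).
split.
- have := ler_normD (x k - xb) xb; rewrite subrK.
  by have := le_trans (sq1 _) (lerD (lexx 1) h1); lra.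
- by have := le_trans (sq1 _) (lerD (lexx 1) h2); lra.
- by have := le_trans (sq1 _) (lerD (lexx 1) h3); lra.
- lra.
- rewrite (residualE k.+1 con); have := ler_normB (residual k.+1) (Bs (z k.+1 - zb)).
  by have := hN k; rewrite normr_id; lra.
Qed.

Lemma Bs_step_cvg0 xb yb zb : kkt f g A As B Bs c (xb, yb, zb) ->
  Bs (z k - z k.+1) @[k --> \oo] --> 0.
Proof.
move=> kk; have [_ _ _ _ b0] := vanishing_terms kk; apply: sqr_norm_cvg0.
have -> : (fun k => `|Bs (z k - z k.+1)| ^+ 2) = (fun k => `|Bs (z k.+1 - z k)| ^+ 2).
  by apply/funext => k; rewrite -opprB linearN normrN.
exact: b0.
Qed.

(** Every term of [gapE] pairs a vanishing factor with one that is bounded in the same seminorm, so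
    [y] and [z] themselves may be unbounded. *)
Lemma gap_cvg0 xb yb zb : kkt f g A As B Bs c (xb, yb, zb) ->
  gap yb zb k @[k --> \oo] --> 0.
Proof.
move=> kk; have [_ _ con] := kk.
have [M hM] := iterates_bounded kk.
have [s0 t0 _ _ _] := vanishing_terms kk.
have r0 := residual_cvg0; have b0 := Bs_step_cvg0 kk.
have -> : gap yb zb = (fun k =>
    - (inner (x k) (residual k.+1) + sigma * inner (residual k.+1) (residual k.+1))
  - sigma * inner (Bs (z k - z k.+1)) (As (y k.+1 - yb))
  - inner (S (y k.+1 - y k)) (y k.+1 - yb)
  - inner (T (z k.+1 - z k)) (z k.+1 - zb)).
  by apply/funext => k; rewrite gapE// (innerDl (x k)) innerZl.
have -> : 0 = - (0 + sigma * inner (0 : X) 0) - sigma * 0 - 0 - 0 :> R.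
  by rewrite inner0l !(mulr0, subr0, addr0, oppr0).
apply: cvgB; first apply: cvgB; first apply: cvgB; first apply: cvgN.
- apply: cvgD; last by apply: cvgM; [exact: cvg_cst|exact: inner_cvg].
  apply: (@norm_le_cvg0 _ _ (fun k => `|residual k.+1|) M) => [k|].
    rewrite (le_trans (cauchy_schwarz _ _))// mulrC ler_wpM2l//.
    by have [] := hM k.
  by apply/norm_cvg0P.
- apply: cvgM; first exact: cvg_cst.
  apply: (@norm_le_cvg0 _ _ (fun k => `|Bs (z k - z k.+1)|) M) => [k|].
    rewrite (le_trans (cauchy_schwarz _ _))// ler_wpM2l//.
    by have [] := hM k.
  by apply/norm_cvg0P.
- apply: (@norm_le_cvg0 _ _ (fun k => opnorm S (y k.+1 - y k)) M) => [k|].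
    rewrite hS.1 (le_trans (opnorm_cauchy_schwarz _ _ hS))//.
    rewrite ler_wpM2l ?opnorm_ge0//.
    by have [] := hM k.+1.
  exact: sqr_cvg0.
- apply: (@norm_le_cvg0 _ _ (fun k => opnorm T (z k.+1 - z k)) M) => [k|].
    rewrite hT.1 (le_trans (opnorm_cauchy_schwarz _ _ hT))//.
    rewrite ler_wpM2l ?opnorm_ge0//.
    by have [] := hM k.+1.
  exact: sqr_cvg0.
Qed.

(** Apart from the multiplier, every ingredient of the subgradients is a residual or an increment
    and vanishes. *)
Lemma f_subgrad_cvg xb yb zb (phi : nat -> nat) (xo : X) :
  kkt f g A As B Bs c (xb, yb, zb) -> (forall n, (n <= phi n)%N) ->
  x (phi n) @[n --> \oo] --> xo ->
  f_subgrad (phi n) @[n --> \oo] --> - A xo /\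
  g_subgrad (phi n) @[n --> \oo] --> - B xo.
Proof.
move=> kk hphi xphi; have oo := subseq_cvg_oo hphi.
have [s0 t0 _ _ _] := vanishing_terms kk.
have r0 := cvg_comp _ _ oo residual_cvg0.
have b0 := cvg_comp _ _ oo (Bs_step_cvg0 kk).
have S0 := cvg_comp _ _ oo (opnorm_cvg0 hS s0).
have T0 := cvg_comp _ _ oo (opnorm_cvg0 hT t0).
split.
- have -> : - A xo = - (A (xo + sigma *: (0 + 0)) + 0) by rewrite !addr0 scaler0 addr0.
  apply: cvgN; apply: cvgD => //; apply: continuous_cvg; first exact: linear_map_continuous.
  by apply: cvgD => //; apply: cvgZl_tmp; exact: cvgD.
- have -> : - B xo = - (B (xo + sigma *: 0) + 0) by rewrite scaler0 !addr0.
  apply: cvgN; apply: cvgD => //; apply: continuous_cvg; first exact: linear_map_continuous.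
  by apply: cvgD => //; apply: cvgZl_tmp.
Qed.

Definition objective k : R := fine (f (y k)) + fine (g (z k)).

(** A squeeze: subgradients at the KKT point bound the objective below up to a multiple of the
    residual, and subgradients at the iterates bound it above up to [gap]. *)
Lemma objective_cvg xb yb zb : kkt f g A As B Bs c (xb, yb, zb) ->
  objective k @[k --> \oo] --> fine (f yb) + fine (g zb).
Proof.
move=> kk; have [fb gb con] := kk.
have [_ pf _] := hf; have [_ pg _] := hg.
have fyb := subdiff_dom pf fb; have gzb := subdiff_dom pg gb.
rewrite -(cvg_shiftS objective).
set p := fine (f yb) + fine (g zb).
apply: (@squeeze_cvgr _ _ _ _ (fun k => p - inner xb (residual k.+1))
  (fun k => p + gap yb zb k)).
- near=> k; rewrite /=; apply/andP; split.
    have := subdiff_fine pf fb (fy k.+1); have := subdiff_fine pg gb (gz k.+1).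
    rewrite (innerNl (A xb)) (innerNl (B xb)) hA hB (residualE k.+1 con) (innerBr xb (residual k.+1)).
    by rewrite /objective /p; lra.
  have := subdiff_fine pf (f_opt k) fyb; have := subdiff_fine pg (g_opt k) gzb.
  rewrite -(opprB (y k.+1)) -(opprB (z k.+1)) !innerNr.
  by rewrite /objective /p /gap; lra.
- rewrite -[X in _ --> X]subr0; apply: cvgB; first exact: cvg_cst.
  rewrite -(inner0r xb); apply: inner_cvg; [exact: cvg_cst|exact: residual_cvg0].
- rewrite -[X in _ --> X]addr0; apply: cvgD; first exact: cvg_cst.
  exact: gap_cvg0 kk.
Unshelve. all: by end_near. Qed.

(* The primal iterates may be unbounded, so the primal part of a known KKT
   point is kept: only the multiplier is replaced by the subsequential limit. *)
Lemma kkt_of_dual_limit xb yb zb (phi : nat -> nat) (xo : X) :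
  kkt f g A As B Bs c (xb, yb, zb) -> (forall n, (n <= phi n)%N) ->
  x (phi n) @[n --> \oo] --> xo -> kkt f g A As B Bs c (xo, yb, zb).
Proof.
move=> kk hphi xphi; have [fb gb con] := kk.
have [_ pf _] := hf; have [_ pg _] := hg.
have fyb := subdiff_dom pf fb; have gzb := subdiff_dom pg gb.
have oo := subseq_cvg_oo hphi.
have [vphi wphi] := f_subgrad_cvg kk hphi xphi.
set p := fine (f yb) + fine (g zb).
have objS : objective k.+1 @[k --> \oo] --> p.
  by rewrite (cvg_shiftS objective); exact: objective_cvg kk.
(* This combination appears when the two subgradient inequalities at an iterate are added, one
   tested at [u] and the other at the known primal point. *)
have lim0 : objective (phi n).+1 - gap yb zb (phi n) @[n --> \oo] --> p.
  rewrite -[X in _ --> X]subr0; apply: cvgB.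
    exact: (cvg_comp _ _ oo objS).
  exact: (cvg_comp _ _ oo (gap_cvg0 kk)).
split => //.
- apply: subdiffP => // u fu.
  have h1 : inner (f_subgrad (phi n)) (u - yb) @[n --> \oo] --> inner (- A xo) (u - yb).
    by apply: inner_cvg => //; exact: cvg_cst.
  suff : p + inner (- A xo) (u - yb) <= fine (f u) + fine (g zb) by rewrite /p; lra.
  apply: (cvgr_to_le (cvgD lim0 h1)); near=> n.
  have := subdiff_fine pf (f_opt (phi n)) fu; have := subdiff_fine pg (g_opt (phi n)) gzb.
  rewrite -(opprB (z _.+1)) (innerNr _ (_ - zb)) /objective /gap.
  have -> : u - y (phi n).+1 = (u - yb) - (y (phi n).+1 - yb) by rewrite opprB addrA subrK.
  by rewrite (innerBr _ (u - yb)) !fctE /=; lra.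
- apply: subdiffP => // u gu.
  have h1 : inner (g_subgrad (phi n)) (u - zb) @[n --> \oo] --> inner (- B xo) (u - zb).
    by apply: inner_cvg => //; exact: cvg_cst.
  suff : p + inner (- B xo) (u - zb) <= fine (f yb) + fine (g u) by rewrite /p; lra.
  apply: (cvgr_to_le (cvgD lim0 h1)); near=> n.
  have := subdiff_fine pf (f_opt (phi n)) fyb; have := subdiff_fine pg (g_opt (phi n)) gu.
  rewrite -(opprB (y _.+1)) (innerNr _ (_ - yb)) /objective /gap.
  have -> : u - z (phi n).+1 = (u - zb) - (z (phi n).+1 - zb) by rewrite opprB addrA subrK.
  by rewrite (innerBr _ (u - zb)) !fctE /=; lra.
Unshelve. all: by end_near. Qed.

(* Opial's argument, with the primal part [(yb, zb)] of the KKT points fixed. *)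
Lemma x_cvg xb yb zb : kkt f g A As B Bs c (xb, yb, zb) ->
  exists2 xo : X, x k @[k --> \oo] --> xo & kkt f g A As B Bs c (xo, yb, zb).
Proof.
move=> kk; have [M hM] := iterates_bounded kk.
have xM k : `|x k| <= M by have [] := hM k.
have [phi [xo hphi xphi]] := bounded_subseq xM.
have kko := kkt_of_dual_limit kk hphi xphi.
exists xo => //; apply: (cvg_of_subseq xM) => psi q hpsi xpsi.
have kkq := kkt_of_dual_limit kk hpsi xpsi.
pose D k := `|x k - xo| ^+ 2 - `|x k - q| ^+ 2.
have [l Dl] : exists l : R, D k @[k --> \oo] --> l.
  (* The two KKT points share their primal part, so all terms in [y] and [z] cancel in the
     difference. *)
  have -> : D = fun k => tau * sigma * (lyapunov xo yb zb k - lyapunov q yb zb k).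
    apply/funext => k; rewrite /D /lyapunov; field.
    by rewrite !gt_eqF.
  exists (tau * sigma * (limn (lyapunov xo yb zb) - limn (lyapunov q yb zb))).
  by apply: cvgM; [exact: cvg_cst|apply: cvgB; exact: lyapunov_cvg].
have Dsub (chi : nat -> nat) (p : X) : (forall n, (n <= chi n)%N) ->
    x (chi n) @[n --> \oo] --> p -> l = `|p - xo| ^+ 2 - `|p - q| ^+ 2.
  move=> hchi xchi.
  have h1 : D (chi n) @[n --> \oo] --> l := cvg_comp _ _ (subseq_cvg_oo hchi) Dl.
  have h2 : D (chi n) @[n --> \oo] --> `|p - xo| ^+ 2 - `|p - q| ^+ 2.
    rewrite /D !expr2; apply: cvgB; apply: cvgM; apply: cvg_norm; apply: cvgB => //;
      exact: cvg_cst.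
  by rewrite -(cvg_lim _ h1)// (cvg_lim _ h2).
(* The limit of [D] is minus the squared distance of [xo] and [q] along [phi], and plus that squared
   distance along [psi]. *)
have := Dsub _ _ hphi xphi; have := Dsub _ _ hpsi xpsi.
rewrite !subrr !normr0 expr0n/= distrC => -> h.
have : `|xo - q| ^+ 2 = 0 by lra.
by move/eqP; rewrite sqrf_eq0 normr_eq0 subr_eq0 => /eqP.
Qed.

(** Subgradients at the KKT point bound both functions below through the bounded images under [As]
    and [Bs]; boundedness of the sum turns each lower bound into an upper bound for the other
    function. *)
Lemma values_bounded xb yb zb : kkt f g A As B Bs c (xb, yb, zb) ->
  exists M : R, forall k, `|fine (f (y k))| <= M /\ `|fine (g (z k))| <= M.
Proof.
move=> kk; have [M hM] := iterates_bounded kk; have [fb gb con] := kk.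
have [_ pf _] := hf; have [_ pg _] := hg.
have fyb := subdiff_dom pf fb; have gzb := subdiff_dom pg gb.
have [N hN] : exists N : R, forall k, `|objective k| <= N.
  by apply: cvgn_norm_bounded; apply/cvg_ex; eexists; exact: objective_cvg kk.
have M0 : 0 <= M by have [h _ _ _ _] := hM 0%N; exact: le_trans (normr_ge0 _) h.
have fl k : fine (f yb) - `|xb| * M <= fine (f (y k.+1)).
  have := subdiff_fine pf fb (fy k.+1); rewrite innerNl hA => h.
  have [_ _ _ _ h5] := hM k.
  have h6 := le_trans (ler_norm _) (cauchy_schwarz xb (As (y k.+1 - yb))).
  have h7 := ler_wpM2l (normr_ge0 xb) h5; lra.
have gl k : fine (g zb) - `|xb| * M <= fine (g (z k.+1)).
  have := subdiff_fine pg gb (gz k.+1); rewrite innerNl hB => h.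
  have [_ _ _ h5 _] := hM k.+1.
  have h6 := le_trans (ler_norm _) (cauchy_schwarz xb (Bs (z k.+1 - zb))).
  have h7 := ler_wpM2l (normr_ge0 xb) h5; lra.
pose K := N + `|fine (f yb)| + `|fine (g zb)| + `|xb| * M.
have fK k : `|fine (f (y k.+1))| <= K.
  have := fl k; have := gl k; have := hN k.+1; rewrite !ler_norml /objective /K.
  have := ler_norm (- fine (f yb)); have := ler_norm (- fine (g zb)).
  rewrite !normrN; have : 0 <= `|xb| * M by exact: mulr_ge0.
  have := normr_ge0 (fine (f yb)); have := normr_ge0 (fine (g zb)).
  have : 0 <= N := le_trans (normr_ge0 _) (hN 0%N).
  by move=> ? ? ? ? ? ? /andP[? ?] ? ?; apply/andP; split; lra.
have gK k : `|fine (g (z k.+1))| <= K.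
  have := fl k; have := gl k; have := hN k.+1; rewrite !ler_norml /objective /K.
  have := ler_norm (- fine (f yb)); have := ler_norm (- fine (g zb)).
  rewrite !normrN; have : 0 <= `|xb| * M by exact: mulr_ge0.
  have := normr_ge0 (fine (f yb)); have := normr_ge0 (fine (g zb)).
  have : 0 <= N := le_trans (normr_ge0 _) (hN 0%N).
  by move=> ? ? ? ? ? ? /andP[? ?] ? ?; apply/andP; split; lra.
have [N1 h1] := @bounded_shift _ _ (fun k => fine (f (y k))) _ fK;
  have [N2 h2] := @bounded_shift _ _ (fun k => fine (g (z k))) _ gK.
by exists (Num.max N1 N2) => k; rewrite !le_max h1 h2 orbT.
Qed.

Lemma primal_iterates_bounded xb yb zb : kkt f g A As B Bs c (xb, yb, zb) ->
  recession_pos f As S -> recession_pos g Bs T ->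
  (exists M : R, forall k, `|y k| <= M) /\ (exists M : R, forall k, `|z k| <= M).
Proof.
move=> kk hrf hrg; have [M hM] := iterates_bounded kk.
have [N hN] := values_bounded kk.
have [_ pf _] := hf; have [_ pg _] := hg.
have [CS CS0 hCS] := psd_bounded hS; have [CT CT0 hCT] := psd_bounded hT.
split.
- have [K hK] : exists K : R, forall k, `|y k.+1| <= K; last exact: (@bounded_shift _ _ y _ hK).
  have h1 := linear_map_bounded_shift (L := As) (u := fun k => y k.+1) (v := yb) (M := M).
  have h2 := linear_map_bounded_shift (L := S) (u := fun k => y k.+1) (v := yb) (M := CS * M).
  apply: (@bounded_of_recession_pos R X Y f As S (fun k => y k.+1)
    (Num.max N (Num.max (M + `|As yb|) (CS * M + `|S yb|)))) => // k.
  + rewrite (proper_fin pf (fy k.+1)) lee_fin le_max.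
    by rewrite (le_trans (ler_norm _) (hN k.+1).1).
  + rewrite !le_max h1 ?orbT// => j; by have [] := hM j.
  + rewrite !le_max h2 ?orbT// => j; rewrite (le_trans (hCS _))// ler_wpM2l//.
    by have [] := hM j.+1.
- have h1 := linear_map_bounded_shift (L := Bs) (u := z) (v := zb) (M := M).
  have h2 := linear_map_bounded_shift (L := T) (u := z) (v := zb) (M := CT * M).
  apply: (@bounded_of_recession_pos R X Z g Bs T z
    (Num.max N (Num.max (M + `|Bs zb|) (CT * M + `|T zb|)))) => // k.
  + rewrite (proper_fin pg (gz k)) lee_fin le_max.
    by rewrite (le_trans (ler_norm _) (hN k).2).
  + rewrite !le_max h1 ?orbT// => j; by have [] := hM j.
  + rewrite !le_max h2 ?orbT// => j; rewrite (le_trans (hCT _))// ler_wpM2l//.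
    by have [] := hM j.
Qed.

(** Once the limit point is known to solve the KKT system, the Lyapunov function centered at it
    converges; it vanishes along the subsequence, hence along the whole sequence. *)
Lemma kkt_of_limit_point xb yb zb (phi : nat -> nat) xo yo zo :
  kkt f g A As B Bs c (xb, yb, zb) -> (forall n, (n <= phi n)%N) ->
  x (phi n) @[n --> \oo] --> xo -> y (phi n) @[n --> \oo] --> yo ->
  z (phi n) @[n --> \oo] --> zo ->
  kkt f g A As B Bs c (xo, yo, zo) /\
  lyapunov xo yo zo k @[k --> \oo] --> 0.
Proof.
move=> kk hphi xphi yphi zphi.
have [lf pf _] := hf; have [lg pg _] := hg.
(* The optimality conditions at the iterate of index [k.+1] involve the
   multiplier of index [k], hence the shifted subsequence [m]. *)
pose m n := (phi n.+1).-1.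
have mS n : (m n).+1 = phi n.+1 by rewrite /m prednK// (leq_trans _ (hphi n.+1)).
have hm n : (n <= m n)%N by rewrite -ltnS mS.
have oo := subseq_cvg_oo hm.
have shift (V : euclideanType R) (u : nat -> V) (p : V) :
    u (phi n) @[n --> \oo] --> p -> u (m n).+1 @[n --> \oo] --> p.
  move=> h; have -> : (fun n => u (m n).+1) = (fun n => (u \o phi) n.+1).
    by apply/funext => n /=; rewrite mS.
  by rewrite (cvg_shiftS (u \o phi)).
have ym := shift _ _ _ yphi; have zm := shift _ _ _ zphi; have xm1 := shift _ _ _ xphi.
have rm : residual (m n).+1 @[n --> \oo] --> 0 := cvg_comp _ _ oo residual_cvg0.
have xm : x (m n) @[n --> \oo] --> xo.
  have -> : (fun n => x (m n)) = fun n => x (m n).+1 - (tau * sigma) *: residual (m n).+1.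
    by apply/funext => n /=; rewrite x_step addrK.
  have -> : xo = xo - (tau * sigma) *: 0 by rewrite scaler0 subr0.
  by apply: cvgB => //; exact: cvgZl_tmp.
have [vm wm] := f_subgrad_cvg kk hm xm.
have con : As yo + Bs zo = c.
  apply/eqP; rewrite -subr_eq0; apply/eqP.
  have h : residual (m n).+1 @[n --> \oo] --> As yo + Bs zo - c.
    apply: cvgB; last exact: cvg_cst.
    by apply: cvgD; apply: continuous_cvg => //; exact: linear_map_continuous.
  by rewrite -(cvg_lim _ h)// (cvg_lim _ rm).
(* Closed graph of the subdifferential: the subgradient inequality at [u n] bounds [h (u n)] by a
   convergent sequence, as [lsc_cvg_le] requires. *)
have sub_lim (V : euclideanType R) (h : V -> \bar R) (u v : nat -> V) (uo vo : V) :
    lower_semicontinuous h -> Defs.proper h -> u n @[n --> \oo] --> uo ->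
    v n @[n --> \oo] --> vo -> (forall n, subdiff h (u n) (v n)) -> subdiff h uo vo.
  move=> lh ph uuo vvo sub w.
  have [hw|nhw] := pselect (dom h w); last first.
    suff -> : h w = +oo%E by rewrite leey.
    by move: nhw; rewrite /dom/= ltey; move/negP/negPn/eqP.
  rewrite (proper_fin ph hw) -leeBrDr// -EFinB.
  apply: (@lsc_cvg_le _ _ h u (fun n => fine (h w) - inner (v n) (w - u n)) _ _ lh uuo).
    apply: cvgB; first exact: cvg_cst.
    by apply: inner_cvg => //; apply: cvgB => //; exact: cvg_cst.
  near=> n; rewrite (proper_fin ph (subdiff_dom ph (sub n))) lee_fin.
  by have := subdiff_fine ph (sub n) hw; lra.
have kko : kkt f g A As B Bs c (xo, yo, zo).
  split=> //.
  - exact: (sub_lim _ _ _ _ _ _ lf pf ym vm (fun n => f_opt (m n))).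
  - exact: (sub_lim _ _ _ _ _ _ lg pg zm wm (fun n => g_opt (m n))).
split=> //.
have cl := lyapunov_cvg kko.
suff l0 : lyapunov xo yo zo (phi n) @[n --> \oo] --> 0.
  have l1 : lyapunov xo yo zo (phi n) @[n --> \oo] --> limn (lyapunov xo yo zo).
    exact: (cvg_comp _ _ (subseq_cvg_oo hphi) cl).
  by rewrite -(cvg_lim _ l0)// (cvg_lim _ l1).
have opn (V : euclideanType R) (P : {linear V -> V}) (u : nat -> V) (p : V) :
    psd P -> u n @[n --> \oo] --> p -> opnorm P (u n - p) ^+ 2 @[n --> \oo] --> 0.
  move=> hP up; under eq_fun do rewrite sqr_opnorm//.
  have up0 : u n - p @[n --> \oo] --> 0.
    by rewrite -[X in _ --> X](subrr p); apply: cvgB => //; exact: cvg_cst.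
  rewrite -(inner0l (P 0)); apply: inner_cvg => //.
  by apply: continuous_cvg => //; exact: linear_map_continuous.
have nrm (V : euclideanType R) (u : nat -> V) :
    u n @[n --> \oo] --> 0 -> `|u n| ^+ 2 @[n --> \oo] --> 0.
  move=> u0; under eq_fun do rewrite sqr_normE.
  by rewrite -(inner0l (0 : V)); exact: inner_cvg.
have -> : 0 = (tau * sigma)^-1 * 0 + sigma * 0 + 0 + 0 :> R by rewrite !mulr0 !addr0.
apply: cvgD; last exact: opn.
apply: cvgD; last exact: opn.
apply: cvgD.
- apply: cvgM; first exact: cvg_cst.
  apply: nrm; rewrite -[X in _ --> X](subrr xo).
  by apply: cvgB => //; exact: cvg_cst.
- apply: cvgM; first exact: cvg_cst.
  apply: nrm; rewrite -[X in _ --> X](linear0 Bs) -(subrr zo).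
  apply: continuous_cvg; first exact: linear_map_continuous.
  by apply: cvgB => //; exact: cvg_cst.
Unshelve. all: by end_near. Qed.

(** The Lyapunov function carries the [S], [T] and [Bs] parts; [As] follows from the residual, and
    the [Sigmaf] and [Sigmag] parts from the vanishing energy decrease. *)
Lemma image_cvg_of_lyapunov xo yo zo : kkt f g A As B Bs c (xo, yo, zo) ->
  lyapunov xo yo zo k @[k --> \oo] --> 0 ->
  [/\ As (y k) @[k --> \oo] --> As yo,
      Sigmaf (y k) @[k --> \oo] --> Sigmaf yo,
      S (y k) @[k --> \oo] --> S yo,
      Bs (z k) @[k --> \oo] --> Bs zo &
      Sigmag (z k) @[k --> \oo] --> Sigmag zo /\ T (z k) @[k --> \oo] --> T zo].
Proof.
move=> kk l0; have [_ _ con] := kk.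
have [_ _ sf0 sg0 _] := vanishing_terms kk.
have tr (V W : euclideanType R) (L : {linear V -> W}) (u : nat -> V) (p : V) :
    L (u k - p) @[k --> \oo] --> 0 -> L (u k) @[k --> \oo] --> L p.
  move=> h; have -> : (fun k => L (u k)) = (fun k => L (u k - p) + L p).
    by apply/funext => k; rewrite linearB subrK.
  by rewrite -[X in _ --> X]add0r; apply: cvgD => //; exact: cvg_cst.
have dom (q : nat -> R) (C : R) : (forall k, 0 <= q k <= lyapunov xo yo zo k * C) ->
    q k @[k --> \oo] --> 0.
  move=> hq; apply: (norm_le_cvg0 (M := C) _ l0) => k; have /andP[q0 q1] := hq k.
  by rewrite ger0_norm.
have pos k := (sqr_ge0 (opnorm S (y k - yo)), sqr_ge0 (opnorm T (z k - zo)),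
  mulr_ge0 (ltW sigma0) (sqr_ge0 `|Bs (z k - zo)|)).
have posx k : 0 <= (tau * sigma)^-1 * `|x k - xo| ^+ 2.
  by rewrite mulr_ge0 ?sqr_ge0// invr_ge0 mulr_ge0// ltW.
have S0 : opnorm S (y k - yo) ^+ 2 @[k --> \oo] --> 0.
  apply: (dom _ 1) => k; rewrite sqr_ge0/= /lyapunov.
  by have := posx k; have [[]] := pos k; lra.
have T0 : opnorm T (z k - zo) ^+ 2 @[k --> \oo] --> 0.
  apply: (dom _ 1) => k; rewrite sqr_ge0/= /lyapunov.
  by have := posx k; have [[]] := pos k; lra.
have B0 : Bs (z k - zo) @[k --> \oo] --> 0.
  apply: sqr_norm_cvg0; apply: (dom _ sigma^-1) => k; rewrite sqr_ge0/= /lyapunov.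
  by rewrite ler_pdivlMr//; have := posx k; have [[]] := pos k; lra.
have A0 : As (y k - yo) @[k --> \oo] --> 0.
  rewrite -(cvg_shiftS (fun k => As (y k - yo))).
  have -> : (fun k => As (y k.+1 - yo)) =
      (fun k => residual k.+1 - Bs (z k.+1 - zo)).
    by apply/funext => k; rewrite (residualE k.+1 con).
  rewrite -(subr0 (0 : X)); apply: cvgB; first exact: residual_cvg0.
  by rewrite (cvg_shiftS (fun k => Bs (z k - zo))).
split; [exact: tr|apply: tr|apply: tr|exact: tr|split; apply: tr];
  exact: opnorm_cvg0.
Qed.

Lemma posdef_cvg (V : euclideanType R) (O : {linear V -> V}) (u : nat -> V) (p : V) :
  posdef O -> O (u k) @[k --> \oo] --> O p ->
  (exists M : R, forall k, `|u k| <= M) -> u k @[k --> \oo] --> p.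
Proof.
move=> pO Oup [M hM]; have [C C0 hC] := posdef_coercive pO.
suff : u k - p @[k --> \oo] --> 0.
  move=> h; have -> : u = (fun k => (u k - p) + p) by apply/funext => k; rewrite subrK.
  by rewrite -[X in _ --> X]add0r; apply: cvgD => //; exact: cvg_cst.
apply: sqr_norm_cvg0.
apply: (@norm_le_cvg0 _ _ (fun k => `|O (u k) - O p|) (C * (M + `|p|))) => [k|].
  rewrite ger0_norm ?sqr_ge0// (le_trans (hC _))// mulrCA ler_wpM2l//.
  rewrite (le_trans (ler_norm _))// (le_trans (cauchy_schwarz _ _))// linearB.
  rewrite mulrC ler_wpM2l// (le_trans (ler_normB _ _))// lerD2r//.
apply/norm_cvg0P; rewrite -[X in _ --> X](subrr (O p)).
by apply: cvgB => //; exact: cvg_cst.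
Qed.

(** Each definite form splits into three squared seminorms, all bounded along the iterates;
    coercivity then bounds the vectors. *)
Lemma posdef_iterates_bounded xb yb zb : kkt f g A As B Bs c (xb, yb, zb) ->
  posdef (fun u => Sigmaf u + A (As u) + S u) ->
  posdef (fun u => Sigmag u + B (Bs u) + T u) ->
  (exists M : R, forall k, `|y k| <= M) /\ (exists M : R, forall k, `|z k| <= M).
Proof.
move=> kk pdf pdg; have [M hM] := iterates_bounded kk.
have [_ _ sf0 sg0 _] := vanishing_terms kk.
have [N1 hN1] := cvgn_norm_bounded (cvgP _ sf0).
have [N2 hN2] := cvgn_norm_bounded (cvgP _ sg0).
have sqM (t : R) : 0 <= t -> t <= M -> t ^+ 2 <= M ^+ 2.
  by move=> t0 tM; rewrite lerXn2r// ?nnegrE// (le_trans t0).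
have bnd (V : euclideanType R) (u : nat -> V) (p : V) (K : R) :
    (forall k, `|u k - p| ^+ 2 <= K) -> forall k, `|u k| <= 1 + K + `|p|.
  move=> uK k; rewrite -[u k in leLHS](subrK p) (le_trans (ler_normD _ _))// lerD2r.
  by have := uK k; have := sqr_ge0 (`|u k - p| - 1); nra.
split.
- pose O : {linear Y -> Y} := (Sigmaf \+ (A \o As)) \+ S.
  have [C C0 hC] := @posdef_coercive R Y O pdf.
  have h k : `|y k.+1 - yb| ^+ 2 <= C * (N1 + M ^+ 2 + M ^+ 2).
    rewrite (le_trans (hC _))// ler_wpM2l//= !innerDr.
    rewrite (innerC _ (A _)) hA -sqr_normE -!sqr_opnorm//.
    have [_ _ _ _ h5] := hM k; have [_ h2 _ _ _] := hM k.+1.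
    rewrite !lerD ?sqM ?opnorm_ge0//.
    by rewrite (le_trans (ler_norm _) (hN1 k.+1)).
  exact: (@bounded_shift _ _ y _ (bnd _ (fun k => y k.+1) yb _ h)).
- pose O : {linear Z -> Z} := (Sigmag \+ (B \o Bs)) \+ T.
  have [C C0 hC] := @posdef_coercive R Z O pdg.
  have h k : `|z k - zb| ^+ 2 <= C * (N2 + M ^+ 2 + M ^+ 2).
    rewrite (le_trans (hC _))// ler_wpM2l//= !innerDr.
    rewrite (innerC _ (B _)) hB -sqr_normE -!sqr_opnorm//.
    have [_ _ h3 h4 _] := hM k.
    rewrite !lerD ?sqM ?opnorm_ge0//.
    by rewrite (le_trans (ler_norm _) (hN2 k)).
  by exists (1 + C * (N2 + M ^+ 2 + M ^+ 2) + `|zb|) => k; exact: (bnd _ z).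
Qed.

(** Boundedness provides a limit point by two successive extractions. The images under the definite
    operators converge along the whole sequence, and coercivity lifts this to [y] and [z]. *)
Lemma posdef_iterates_cvg xb yb zb : kkt f g A As B Bs c (xb, yb, zb) ->
  posdef (fun u => Sigmaf u + A (As u) + S u) ->
  posdef (fun u => Sigmag u + B (Bs u) + T u) ->
  exists (xo : X) (yo : Y) (zo : Z),
    [/\ kkt f g A As B Bs c (xo, yo, zo), x k @[k --> \oo] --> xo,
        y k @[k --> \oo] --> yo & z k @[k --> \oo] --> zo].
Proof.
move=> kk pdf pdg; have [[M1 yM] [M2 zM]] := posdef_iterates_bounded kk pdf pdg.
have [xo xxo _] := x_cvg kk.
have [phi1 [yo hphi1 yphi1]] := bounded_subseq yM.
have [phi2 [zo hphi2 zphi2]] := bounded_subseq (fun n => zM (phi1 n)).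
have hphi n : (n <= phi1 (phi2 n))%N by rewrite (leq_trans (hphi2 n)).
have [kko l0] := kkt_of_limit_point kk hphi (cvg_comp _ _ (subseq_cvg_oo hphi) xxo)
  (cvg_comp _ _ (subseq_cvg_oo hphi2) yphi1) zphi2.
have [cA cf cS cB [cg cT]] := image_cvg_of_lyapunov kko l0.
exists xo, yo, zo; split => //.
- apply: (@posdef_cvg Y ((Sigmaf \+ (A \o As)) \+ S) y yo pdf); last by exists M1.
  apply: cvgD => //; apply: cvgD => //.
  exact: (continuous_cvg _ (@linear_map_continuous R X Y A (As yo)) cA).
- apply: (@posdef_cvg Z ((Sigmag \+ (B \o Bs)) \+ T) z zo pdg); last by exists M2.
  apply: cvgD => //; apply: cvgD => //.
  exact: (continuous_cvg _ (@linear_map_continuous R X Z B (Bs zo)) cB).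
Qed.

End Iteration.

(** * The scheme *)

Section Scheme.
Context {R : realType} {X Y Z : euclideanType R}.
Variables (f : Y -> \bar R) (g : Z -> \bar R).
Variables (A : {linear X -> Y}) (As : {linear Y -> X}).
Variables (B : {linear X -> Z}) (Bs : {linear Z -> X}) (c : X).
Variables (sigma tau : R) (S : {linear Y -> Y}) (T : {linear Z -> Z}).
Hypotheses (hf : closed_proper_convex f) (hg : closed_proper_convex g).
Hypotheses (hA : adjoint A As) (hB : adjoint B Bs).
Hypotheses (sigma0 : 0 < sigma) (tau0 : 0 < tau) (hS : psd S) (hT : psd T).

Local Notation y_obj := (y_objective f g As Bs c sigma S).
Local Notation z_obj := (z_objective f g As Bs c sigma T).

(** Finiteness of [g z] turns it into the additive constant [gamma] of the template. *)
Lemma y_objectiveE x y z : dom g z -> y_obj x y z =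
  prox_objective f As S sigma x (Bs z - c) y (fine (g z)).
Proof.
move=> gz; apply/funext => v; have [_ pg _] := hg.
rewrite /y_objective /aug_lagrangian (proper_fin pg gz) /prox_objective /prox_quad.
by rewrite -!addeA -!EFinD !addrA.
Qed.

Lemma z_objectiveE x y z : dom f y -> z_obj x y z =
  prox_objective g Bs T sigma x (As y - c) z (fine (f y)).
Proof.
move=> fy; apply/funext => v; have [_ pf _] := hf.
rewrite /z_objective /aug_lagrangian (proper_fin pf fy) /prox_objective /prox_quad.
rewrite [((fine (f y))%:E + _)%E]addeC -!addeA -!EFinD !addrA.
by rewrite [As y + Bs v]addrC.
Qed.

Lemma y_subproblem_optimality x y z y' : dom g z -> argmin (y_obj x y z) y' ->
  dom f y' /\
  subdiff f y' (- (A (x + sigma *: (As y' + (Bs z - c))) + S (y' - y))).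
Proof.
move=> gz; rewrite y_objectiveE// => /(argmin_prox_subdiff hf hA hS sigma0).
exact.
Qed.

Lemma z_subproblem_optimality x y z z' : dom f y -> argmin (z_obj x y z) z' ->
  dom g z' /\
  subdiff g z' (- (B (x + sigma *: (Bs z' + (As y - c))) + T (z' - z))).
Proof.
move=> fy; rewrite z_objectiveE// => /(argmin_prox_subdiff hg hB hT sigma0).
exact.
Qed.

Lemma subproblems_solvable :
  recession_pos_mod_constancy f As S -> recession_pos_mod_constancy g Bs T ->
  forall x y z, dom f y -> dom g z -> argmin (y_obj x y z) !=set0 /\
    forall y', argmin (y_obj x y z) y' -> argmin (z_obj x y' z) !=set0.
Proof.
move=> hrf hrg x y z fy gz; split.
  by rewrite y_objectiveE//; exact: (argmin_prox_nonempty hf hA hS sigma0).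
move=> y' /(y_subproblem_optimality gz)[fy' _].
by rewrite z_objectiveE//; exact: (argmin_prox_nonempty hg hB hT sigma0).
Qed.

Lemma spadmm_exists :
  recession_pos_mod_constancy f As S -> recession_pos_mod_constancy g Bs T ->
  forall x0 y0 z0, dom f y0 -> dom g z0 ->
    exists (x : nat -> X) (y : nat -> Y) (z : nat -> Z),
      [/\ x 0%N = x0, y 0%N = y0, z 0%N = z0 & spadmm f g As Bs c sigma S T tau x y z].
Proof.
move=> hrf hrg x0 y0 z0 fy0 gz0.
have solv := subproblems_solvable hrf hrg.
(* [xget] falls back on 0 for an empty argmin; the invariant [inv] keeps the orbit in the domains,
   where both subproblems are solvable. *)
pose next (s : X * Y * Z) : X * Y * Z :=
  let y' := xget 0 (argmin (y_obj s.1.1 s.1.2 s.2)) in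
  let z' := xget 0 (argmin (z_obj s.1.1 y' s.2)) in
  (s.1.1 + (tau * sigma) *: (As y' + Bs z' - c), y', z').
pose s k := iter k next (x0, y0, z0).
have nextP u : dom f u.1.2 -> dom g u.2 ->
    argmin (y_obj u.1.1 u.1.2 u.2) (next u).1.2 /\
    argmin (z_obj u.1.1 (next u).1.2 u.2) (next u).2.
  move=> fu gu; have [[v hv] h] := solv u.1.1 _ _ fu gu.
  have hy : argmin (y_obj u.1.1 u.1.2 u.2) (next u).1.2 := xgetI 0 hv.
  have [w hw] := h _ hy; split=> //; exact: (xgetI 0 hw).
have inv k : dom f (s k).1.2 /\ dom g (s k).2.
  elim: k => [//|k [fk gk]].
  have [hy hz] := nextP _ fk gk.
  have [fk' _] := y_subproblem_optimality gk hy.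
  by have [gk' _] := z_subproblem_optimality fk' hz.
exists (fun k => (s k).1.1), (fun k => (s k).1.2), (fun k => (s k).2); split=> // k.
by have [fk gk] := inv k; have [hy hz] := nextP _ fk gk.
Qed.

Lemma spadmm_optimality (x : nat -> X) (y : nat -> Y) (z : nat -> Z) :
  dom f (y 0%N) -> dom g (z 0%N) -> spadmm f g As Bs c sigma S T tau x y z ->
  [/\ forall k, dom f (y k), forall k, dom g (z k),
      forall k, subdiff f (y k.+1) (f_subgrad A As Bs c sigma S x y z k),
      forall k, subdiff g (z k.+1) (g_subgrad As B Bs c sigma T x y z k) &
      forall k, x k.+1 = x k + (tau * sigma) *: residual As Bs c y z k.+1].
Proof.
move=> fy0 gz0 hsp.
have doms k : dom f (y k) /\ dom g (z k).
  elim: k => [//|k [fk gk]]; have [hy hz _] := hsp k.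
  have [fk' _] := y_subproblem_optimality gk hy.
  by have [gk' _] := z_subproblem_optimality fk' hz.
split=> k; try by have [] := doms k.
- have [hy _ _] := hsp k; have [_ h] := y_subproblem_optimality (doms k).2 hy.
  move: h; rewrite /f_subgrad /residual; congr (subdiff f _ (- (A (_ + _ *: _) + _))).
  rewrite (linearB Bs) [Bs (z k) - Bs _]addrC [As _ + Bs (z k.+1) - c]addrAC [RHS]addrA addrK.
  by rewrite -[RHS]addrA [- c + _]addrC.
- have [_ hz _] := hsp k; have [_ h] := z_subproblem_optimality (doms k.+1).1 hz.
  move: h; rewrite /g_subgrad /residual; congr (subdiff g _ (- (B (_ + _ *: _) + _))).
  by rewrite addrA [Bs _ + As _]addrC.
- by have [_ _] := hsp k.
Qed.

End Scheme.

Theorem theorem4p1 (R : realType) (X Y Z : euclideanType R)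
    (f : Y -> \bar R) (g : Z -> \bar R)
    (A : {linear X -> Y}) (As : {linear Y -> X})
    (B : {linear X -> Z}) (Bs : {linear Z -> X}) (c : X)
    (sigma tau : R)
    (S Sigmaf : {linear Y -> Y}) (T Sigmag : {linear Z -> Z})
    (hf : closed_proper_convex f) (hg : closed_proper_convex g)
    (hA : adjoint A As) (hB : adjoint B Bs)
    (hsigma : 0 < sigma) (htau : 0 < tau)
    (hS : psd S) (hT : psd T)
    (hSigmaf : psd Sigmaf) (hSigmag : psd Sigmag)
    (hfmono : subdiff_monotone_wrt f Sigmaf)
    (hgmono : subdiff_monotone_wrt g Sigmag)
    (hkkt : kkt f g A As B Bs c !=set0) :
  (* solvability of the subproblems and existence of an infinite sequence *)
  (recession_pos_mod_constancy f As S ->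
   recession_pos_mod_constancy g Bs T ->
   (forall (x : X) (y : Y) (z : Z), dom f y -> dom g z ->
      argmin (y_objective f g As Bs c sigma S x y z) !=set0 /\
      forall y' : Y, argmin (y_objective f g As Bs c sigma S x y z) y' ->
        argmin (z_objective f g As Bs c sigma T x y' z) !=set0) /\
   (forall (x0 : X) (y0 : Y) (z0 : Z), dom f y0 -> dom g z0 ->
      exists (x : nat -> X) (y : nat -> Y) (z : nat -> Z),
        [/\ x 0%N = x0, y 0%N = y0, z 0%N = z0 &
            spadmm f g As Bs c sigma S T tau x y z])) /\
  (forall (x : nat -> X) (y : nat -> Y) (z : nat -> Z),
     dom f (y 0%N) -> dom g (z 0%N) ->
     spadmm f g As Bs c sigma S T tau x y z ->
     (tau < (1 + Num.sqrt 5) / 2 \/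
      ((1 + Num.sqrt 5) / 2 <= tau /\
       (\sum_(0 <= k <oo) (`|x k.+1 - x k| ^+ 2)%:E < +oo)%E)) ->
     [/\
       (* (a) *)
       (exists xbar : X, dual_solution f g A B c xbar /\
          x k @[k --> \oo] --> xbar) /\
       ((f (y k) + g (z k))%E @[k --> \oo] --> primal_value f g As Bs c),
       (* (b) *)
       [/\ exists M : R, forall k, (`|f (y k)| <= M%:E)%E,
           exists M : R, forall k, (`|g (z k)| <= M%:E)%E &
           recession_pos f As S -> recession_pos g Bs T ->
           (exists M : R, forall k, `|y k| <= M) /\
           (exists M : R, forall k, `|z k| <= M)],
       (* (c) *)
       forall (xoo : X) (yoo : Y) (zoo : Z),
         cluster ((x k, y k, z k) @[k --> \oo]) (xoo, yoo, zoo) ->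
         kkt f g A As B Bs c (xoo, yoo, zoo) /\
         [/\ As (y k) @[k --> \oo] --> As yoo,
             (Sigmaf (y k) + S (y k)) @[k --> \oo] --> Sigmaf yoo + S yoo,
             Bs (z k) @[k --> \oo] --> Bs zoo &
             (Sigmag (z k) + T (z k)) @[k --> \oo] --> Sigmag zoo + T zoo] &
       (* (d) *)
       posdef (fun u => Sigmaf u + A (As u) + S u) ->
       posdef (fun u => Sigmag u + B (Bs u) + T u) ->
       (forall k,
          (exists! y' : Y,
             argmin (y_objective f g As Bs c sigma S (x k) (y k) (z k)) y') /\
          (exists! z' : Z,
             argmin (z_objective f g As Bs c sigma T (x k) (y k.+1) (z k)) z')) /\
       exists (xbar : X) (ybar : Y) (zbar : Z),
         [/\ kkt f g A As B Bs c (xbar, ybar, zbar),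
             x k @[k --> \oo] --> xbar,
             y k @[k --> \oo] --> ybar &
             z k @[k --> \oo] --> zbar]]).
Proof.
  split.
    move=> hrf hrg; split.
      exact: (subproblems_solvable c hf hg hA hB hsigma hS hT hrf hrg).
    exact: (spadmm_exists c tau hf hg hA hB hsigma hS hT hrf hrg).
  have [[[xb yb] zb] kk] := hkkt.
  have [_ pf _] := hf; have [_ pg _] := hg.
  move=> x y z fy0 gz0 hsp hcase.
  have [fy gz fopt gopt xstep] :=
    spadmm_optimality hf hg hA hB hsigma hS hT fy0 gz0 hsp.
  (* The two alternatives on [tau] meet here; all four conclusions follow from this bound. *)
  have rsum : exists K : R, forall n,
      \sum_(0 <= i < n) `|residual As Bs c y z i.+1| ^+ 2 <= K.
    case: hcase => [tau_small|[_ steps]].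
      exact: (residual_summable_small_tau hA hB hsigma htau hS hT
        hfmono hgmono fopt gopt xstep kk tau_small).
    exact: (residual_summable_of_steps hsigma htau xstep steps).
  split.
  - split.
      have [xo xxo kko] := x_cvg hf hg hA hB hsigma htau hS hT hfmono hgmono
        fy gz fopt gopt xstep rsum kk.
      by exists xo; split => //; exact: (kkt_dual_solution pf pg hA hB kko).
    rewrite (kkt_primal_value pf pg hA hB kk).
    have -> : (fun k => f (y k) + g (z k))%E = (fun k => (objective f g y z k)%:E).
      by apply/funext => k; rewrite (proper_fin pf (fy k)) (proper_fin pg (gz k)).
    apply: cvg_EFin; first by near=> k.
    exact: (objective_cvg hf hg hA hB hsigma htau hS hT hfmono hgmono
      fy gz fopt gopt xstep rsum kk).
  - have [M hM] := values_bounded hf hg hA hB hsigma htau hS hT hfmono hgmono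
      fy gz fopt gopt xstep rsum kk.
    split.
    + by exists M => k; rewrite (proper_fin pf (fy k)) lee_fin (hM k).1.
    + by exists M => k; rewrite (proper_fin pg (gz k)) lee_fin (hM k).2.
    + exact: (primal_iterates_bounded hf hg hA hB hsigma htau hS hT hfmono hgmono
        fy gz fopt gopt xstep rsum kk).
  - move=> xo yo zo /cluster_subseq[phi hphi xyz].
    have xphi : x (phi n) @[n --> \oo] --> xo.
      exact: (cvg_comp _ _ (cvg_comp _ _ xyz cvg_fst) cvg_fst).
    have yphi : y (phi n) @[n --> \oo] --> yo.
      exact: (cvg_comp _ _ (cvg_comp _ _ xyz cvg_fst) cvg_snd).
    have zphi : z (phi n) @[n --> \oo] --> zo by exact: (cvg_comp _ _ xyz cvg_snd).
    have [kko l0] := kkt_of_limit_point hf hg hA hB hsigma htau hS hT hfmono hgmono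
      fopt gopt xstep rsum kk hphi xphi yphi zphi.
    have [cA cf cS cB [cg cT]] := image_cvg_of_lyapunov hA hB hsigma htau hS hT
      hSigmaf hSigmag hfmono hgmono fopt gopt xstep rsum kko l0.
    by split=> //; split=> //; exact: cvgD.
  - move=> pdf pdg; split; last first.
      exact: (posdef_iterates_cvg hf hg hA hB hsigma htau hS hT hSigmaf hSigmag
        hfmono hgmono fy gz fopt gopt xstep rsum kk pdf pdg).
    move=> k; have [hy hz _] := hsp k; split.
    (* Existence is given by the iterate that the scheme selected; definiteness provides
       uniqueness. *)
    + exists (y k.+1); split=> // y'; move: hy; rewrite y_objectiveE//.
      exact: (argmin_prox_unique hf hA hS hsigma hSigmaf hfmono pdf).
    + exists (z k.+1); split=> // z'; move: hz; rewrite z_objectiveE//.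
      exact: (argmin_prox_unique hg hB hT hsigma hSigmag hgmono pdg).
Unshelve. all: by end_near.
Qed.
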